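(* Consider the Cauchy problem $$u_t+D_x u=\mp u^2,\qquad u(0,\cdot)=u_0,\qquad x\in\mathbb{R}$$ (the quadratic fractional heat equation with $\alpha=1/2$). There exist a sequence $T_N\searrow 0$ and a sequence of initial data $\{\phi_N\}\subset L^2(\mathbb{R})$ such that the emanating solutions $u_N$ (that is, the solutions with $u_N(0,\cdot)=\phi_N$) belong to $C([0,T_N];L^2(\mathbb{R}))$ and satisfy $$\|\phi_N\|_{H^{-1/2}(\mathbb{R})}\to 0\quad\text{and}\quad \|u_N(T_N)\|_{H^{-1/2}(\mathbb{R})}\to+\infty\quad\text{as }N\to\infty.$$
   Context: The unknown $u=u(t,x)$ is real-valued. $D_x$ is the Fourier multiplier by $|\xi|$, and $S_{1/2}(t)$ is the semigroup $\mathcal{F}(S_{1/2}(t)\varphi)(\xi)=e^{-t|\xi|}\mathcal{F}(\varphi)(\xi)$. The sign $\mp$ in front of $u^2$ is fixed, either choice being allowed. Solutions are understood as solutions of the integral equation $$u(t)=S_{1/2}(t)u_0\mp\int_0^t S_{1/2}(t-\sigma)\big(u^2(\sigma)\big)\,d\sigma.$$ $H^{-1/2}(\mathbb{R})$ is the Sobolev space with norm $\|u\|_{H^{-1/2}(\mathbb{R})}=\big(\int_{\mathbb{R}}(1+|\xi|^2)^{-1/2}|\mathcal{F}(u)(\xi)|^2\,d\xi\big)^{1/2}$. *)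

(* Defs.v *)
From HB Require Import structures.
From mathcomp Require Import all_boot all_order all_algebra.
From mathcomp Require Import complex.
From mathcomp Require Import all_classical all_reals all_analysis.
From mathcomp Require Import measurable_realfun.

Set Implicit Arguments.
Unset Strict Implicit.
Unset Printing Implicit Defensive.

Import Order.TTheory GRing.Theory Num.Theory.
Import numFieldNormedType.Exports.

Local Open Scope classical_set_scope.
Local Open Scope ring_scope.
Local Open Scope complex_scope.

Section Fourier.
Context {R : realType}.
Local Notation mu := (@lebesgue_measure R).

Definition cintegrable (f : R -> R[i]) : Prop :=
  mu.-integrable setT (fun x => (complex.Re (f x))%:E) /\
  mu.-integrable setT (fun x => (complex.Im (f x))%:E).

Definition cintegral (f : R -> R[i]) : R[i] :=
  (\int[mu]_x complex.Re (f x)) +i* (\int[mu]_x complex.Im (f x)).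

Definition schwartz (psi : R -> R) : Prop :=
  forall n : nat, (forall x : R, derivable (derive1n n psi) x 1) /\
    forall k : nat, exists C : R, forall x : R, `|x ^+ k * derive1n n psi x| <= C.

(* The convention is F(psi)(xi) = \int e^{-i x xi} psi(x) dx, so that D_x is
   the multiplier by |xi| without any factor 2 pi. *)
Definition fourier_integral (psi : R -> R) (xi : R) : R[i] :=
  cintegral (fun x => (psi x)%:C * (cos (x * xi) -i* sin (x * xi))).

(* [is_fourier f g]: the Fourier transform of f, taken in the sense of
   tempered distributions, is the function g, i.e. <f, F psi> = <g, psi> for
   all Schwartz psi (real psi suffice, by linearity).  It determines g up to a
   null set, is the Fourier integral of f when f is in L^1, and the Plancherel
   transform of f when f is in L^2. *)
Definition is_fourier (f : R -> R) (g : R -> R[i]) : Prop :=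
  forall psi, schwartz psi ->
    [/\ cintegrable (fun x => (f x)%:C * fourier_integral psi x),
        cintegrable (fun xi => g xi * (psi xi)%:C) &
        cintegral (fun x => (f x)%:C * fourier_integral psi x) =
        cintegral (fun xi => g xi * (psi xi)%:C)].

(* [is_sobolev_norm s f r]: f belongs to H^s(R), with norm r. *)
Definition is_sobolev_norm (s : R) (f : R -> R) (r : R) : Prop :=
  exists g, let h := fun xi => (1 + `|xi| ^+ 2) `^ s *
      (complex.Re (g xi) ^+ 2 + complex.Im (g xi) ^+ 2) in
    [/\ is_fourier f g, mu.-integrable setT (EFin \o h) &
        r = Num.sqrt (\int[mu]_xi h xi)].

(* [is_frac_heat t f h]: h = S_{1/2}(t) f. *)
Definition is_frac_heat (t : R) (f h : R -> R) : Prop :=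
  exists2 g, is_fourier f g &
    is_fourier h (fun xi => (expR (- t * `|xi|))%:C * g xi).

End Fourier.

(* Elements of L^2(R) are represented by square-integrable functions R -> R,
   and equality in L^2(R) by almost everywhere equality. *)
Section L2.
Context {R : realType}.
Local Notation mu := (@lebesgue_measure R).

Definition in_L2 (f : R -> R) : Prop := f \in Lfun mu 2%:E.

Definition L2_dist (f g : R -> R) : \bar R :=
  Lnorm mu 2%:E (EFin \o (f \- g)).

Definition continuous_L2 (T : R) (u : R -> R -> R) : Prop :=
  (forall t : R, t \in `[0, T] -> in_L2 (u t)) /\
  (forall t : R, t \in `[0, T] ->
     L2_dist (u s) (u t) @[s --> within `[0, T] (nbhs t)] --> 0%E).

Record L2_simple (D : set R) := L2Simple {
  simple_size : nat ;
  simple_set : 'I_simple_size -> set R ;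
  simple_val : 'I_simple_size -> R -> R ;
  simple_setP : forall i, [/\ measurable (simple_set i), simple_set i `<=` D &
    (mu (simple_set i) < +oo)%E] ;
  simple_valP : forall i, in_L2 (simple_val i) }.

Arguments simple_set {D} s i : rename.
Arguments simple_val {D} s i x : rename.

Definition simple_fun D (s : L2_simple D) (t : R) : R -> R := fun x =>
  \sum_(i < simple_size s) \1_(simple_set s i) t * simple_val s i x.

Definition simple_integral D (s : L2_simple D) : R -> R := fun x =>
  \sum_(i < simple_size s) fine (mu (simple_set s i)) * simple_val s i x.

(* [is_bochner D F w]: F : D -> L^2(R) is Bochner integrable over D, and its
   Bochner integral is w. *)
Definition is_bochner (D : set R) (F : R -> R -> R) (w : R -> R) : Prop :=
  [/\ forall t, D t -> in_L2 (F t), in_L2 w &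
    exists s : nat -> L2_simple D,
      [/\ forall k, measurable_fun D (fun t => L2_dist (F t) (simple_fun (s k) t)),
          (\int[mu]_(t in D) L2_dist (F t) (simple_fun (s k) t))%E
            @[k --> \oo] --> 0%E &
          L2_dist w (simple_integral (s k)) @[k --> \oo] --> 0%E]].

(* [is_solution eps T u0 u]: u is in C([0,T]; L^2(R)), u(0) = u0, and
     u(t) = S_{1/2}(t) u0 + eps \int_0^t S_{1/2}(t - s) (u^2(s)) ds
   in L^2(R) for all t in [0,T].  The integral is over [0,t[ because at s = t
   the integrand u^2(t) need only be in L^1(R). *)
Definition is_solution (eps T : R) (u0 : R -> R) (u : R -> R -> R) : Prop :=
  [/\ continuous_L2 T u,
      u 0 = u0 %[ae mu] &
      forall t : R, t \in `[0, T] -> exists (v : R -> R) (F : R -> R -> R) (w : R -> R),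
        [/\ is_frac_heat t u0 v,
            forall s : R, s \in `[0, t[ ->
              is_frac_heat (t - s) (fun x => u s x ^+ 2) (F s),
            is_bochner `[0, t[ F w &
            u t = (fun x => v x + eps * w x) %[ae mu]]].

End L2.

(* Main.v *)
Require Import Defs.
From HB Require Import structures.
From mathcomp Require Import all_boot all_order all_algebra.
From mathcomp Require Import complex.
From mathcomp Require Import all_classical all_reals all_analysis.
From mathcomp Require Import measurable_realfun.
From mathcomp Require Import ring lra.

Import Order.TTheory GRing.Theory Num.Theory.
Import numFieldNormedType.Exports.

Local Open Scope classical_set_scope.
Local Open Scope ring_scope.

Set Implicit Arguments.
Unset Strict Implicit.
Unset Printing Implicit Defensive.

(* The Lorentzians u(t,x) = 2ab / (x^2 + b^2), with Fourier transform
   2 pi a e^{-b|xi|}, form an invariant family: the square of u has Fourier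
   transform 2 pi a^2 (1/b + |xi|) e^{-b|xi|}, so that u solves
   u_t + D_x u = eps u^2 as soon as a' = eps a^2 / b and b' = 1 - eps a.
   For eps = 1 put s = 1/a: the quantity b a e^{1/a} = C is conserved, hence
   b = C s e^{-s} and t = C (g(s) - g(s0)) with g(s) = (1 + s) e^{-s}; the case
   eps = -1 follows by changing the sign of a.  The square of the H^{-1/2} norm
   is a^2 times a quantity of size log(1/b) for small b.  Starting from
   1/a = N + 2, where a^2 log(1/b) = O(1/N), the solution reaches a = N + 1 with
   b bounded, at a time that the choice of C makes equal to 1/(N + 1). *)

(** * Integration on the line *)

(** Smallness of the data rests on the conserved quantity: amplitude 1/s comes with width C s
    e^{-s}, so log(1/b) is at most of order s as long as C s >= 1, and the squared norm a^2 log(1/b)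
    is then O(1/s), which vanishes as s grows. The passage from s0 >= 2 to s1 <= 1 always covers
    [1, 2], so C stays between the elapsed time and a fixed constant; this keeps the initial width
    from being too small and the final one from being too large. The other difficulty is the
    integral equation, stated with tempered Fourier transforms and a Bochner integral in L^2. The
    semigroup only shifts the width of a Lorentzian, so every term of the equation is explicit.
    Since eps^2 = 1, the derivative of eps S(t - s) u(s) in s is S(t - s) u^2(s), and the Duhamel
    formula becomes a fundamental theorem of calculus. That derivative is pointwise in x; the
    transfer to L^2 uses a common majorant, a multiple of 1/(1 + x^2), for the functions and their
    increments in time. *)

Lemma integrable_le d (T : measurableType d) (R : realType)
    (mu : {measure set T -> \bar R}) (f g : T -> R) :
  measurable_fun setT f ->
  mu.-integrable setT (EFin \o g) -> (forall x, `|f x| <= g x) ->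
  mu.-integrable setT (EFin \o f).
Proof.
move=> mf ig fg; apply: (le_integrable measurableT _ _ ig).
  exact/measurable_EFinP.
by move=> x _ /=; rewrite lee_fin (le_trans (fg x))// ler_norm.
Qed.

(** The kernel [c] will be a product of cosines, or a cosine or sine of a product. The two
    integrability conclusions are those that [is_fourier] demands besides the equality. *)
Lemma Fubini_bounded d1 d2 (T1 : measurableType d1) (T2 : measurableType d2)
    (R : realType) (m1 : {sigma_finite_measure set T1 -> \bar R})
    (m2 : {sigma_finite_measure set T2 -> \bar R})
    (f : T1 -> R) (g : T2 -> R) (c : T1 -> T2 -> R) :
  m1.-integrable setT (EFin \o f) -> m2.-integrable setT (EFin \o g) ->
  measurable_fun setT (fun z : T1 * T2 => c z.1 z.2) ->
  (forall x y, `|c x y| <= 1) ->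
  [/\ m1.-integrable setT (EFin \o fun x => f x * \int[m2]_y (g y * c x y)),
      m2.-integrable setT (EFin \o fun y => (\int[m1]_x (f x * c x y)) * g y) &
      \int[m1]_x (f x * \int[m2]_y (g y * c x y)) =
      \int[m2]_y ((\int[m1]_x (f x * c x y)) * g y)].
Proof.
move=> if_ ig mc c1.
have mf : measurable_fun setT f by apply/measurable_EFinP;
  case/integrableP: if_.
have mg : measurable_fun setT g by apply/measurable_EFinP; case/integrableP: ig.
pose k (z : T1 * T2) : R := f z.1 * g z.2 * c z.1 z.2.
have mk : measurable_fun setT (EFin \o k).
  apply/measurable_EFinP; apply: measurable_funM => //; apply: measurable_funM.
    exact: (measurableT_comp mf).
  exact: (measurableT_comp mg).
have igc x : m2.-integrable setT (EFin \o (fun y => g y * c x y)).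
  apply: (@integrable_le _ _ _ _ _ (fun y => `|g y|)).
  - apply: measurable_funM => //.
    exact: (measurableT_comp mc (measurable_pair1 x)).
  - by apply: integrable_norm.
  - by move=> y; rewrite normrM ler_piMr.
have ifc y : m1.-integrable setT (EFin \o (fun x => f x * c x y)).
  apply: (@integrable_le _ _ _ _ _ (fun x => `|f x|)).
  - apply: measurable_funM => //.
    exact: (measurableT_comp mc (measurable_pair2 y)).
  - by apply: integrable_norm.
  - by move=> x; rewrite normrM ler_piMr.
(* By Tonelli, with the majorant |f| |g| that comes from |c| <= 1. *)
have ik : (m1 \x m2)%E.-integrable setT (EFin \o k).
  apply/integrable12ltyP => //.
  apply: (@le_lt_trans _ _ (\int[m1]_x (`|f x| * \int[m2]_y `|g y|)%:E)%E).
    apply: ge0_le_integral => //.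
    + by move=> x _; exact: integral_ge0.
    + apply: (@measurable_fun_fubini_tonelli_F _ _ _ _ _ _ (abse \o (EFin \o
      k))) => //; last by move=> z; exact: abse_ge0.
      exact: measurableT_comp.
    + apply/measurable_EFinP; apply: measurable_funM => //.
      exact: measurableT_comp.
    + move=> x _; rewrite EFinM.
      rewrite -[X in (_ * X)%E](_ : \int[m2]_y (`|g y|)%:E = _)%E; last first.
        rewrite fineK//; apply: (integrable_fin_num measurableT).
        exact: integrable_norm.
      rewrite -ge0_integralZl//; last by apply/measurable_EFinP;
        exact: measurableT_comp.
      apply: ge0_le_integral => //.
      * by apply: measurableT_comp => //; apply: (measurableT_comp mk
        (measurable_pair1 x)).
      * apply/measurable_EFinP; apply: measurable_funM => //.
        exact: measurableT_comp.
      * move=> y _ /=; rewrite lee_fin /k/= 2!normrM ler_piMr//.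
  have : m1.-integrable setT (EFin \o fun x => `|f x| * \int[m2]_y `|g y|).
    rewrite (_ : _ \o _ = (fun x => (\int[m2]_y `|g y|)%R%:E * (`|f x|)%:E)%E);
      last first.
      by apply/funext => x /=; rewrite -EFinM mulrC.
    by apply: integrableZl => //; exact: integrable_norm.
  move=> /integrableP[_]; under eq_integral do rewrite /= ger0_norm ?mulr_ge0
    ?Rintegral_ge0//.
  by [].
have E1 x :
  (\int[m2]_y ((EFin \o k) (x, y)) = (f x * \int[m2]_y (g y * c x y))%:E)%E.
  rewrite -RintegralZl// fineK//; last first.
    apply: (integrable_fin_num measurableT).
    exact: (integrableZl measurableT (f x) (igc x)).
  by apply: eq_integral => y _; rewrite /k /= mulrA.
have E2 y :
  (\int[m1]_x ((EFin \o k) (x, y)) = (\int[m1]_x (f x * c x y) * g y)%:E)%E.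
  rewrite -RintegralZr// fineK//; last first.
    apply: (integrable_fin_num measurableT).
    exact: (integrableZr measurableT (g y) (ifc y)).
  by apply: eq_integral => x _; rewrite /k /= mulrAC.
split.
- rewrite (_ : _ \o _ = fubini_F m2 (EFin \o k));
  first exact: integrable_fubini_F.
  by apply/funext => x; rewrite /fubini_F E1.
- apply: (@integrable_le _ _ _ _ _ (fun y => \int[m1]_x `|f x| * `|g y|)).
  + apply/measurable_EFinP; rewrite (_ : _ \o _ = fubini_G m1 (EFin \o k)).
      exact: (measurable_fubini_G ik).
    by apply/funext => y; rewrite /fubini_G E2.
  + have := integrable_norm ig.
    exact: (integrableZl measurableT (\int[m1]_x `|f x|)).
  + move=> y; rewrite normrM ler_wpM2r//.
    apply: (le_trans (le_normr_Rintegral _ _)) => //.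
    apply: le_Rintegral => //; [exact: integrable_norm..|].
    by move=> x _; rewrite normrM ler_piMr.
- rewrite /Rintegral; congr fine.
  under eq_integral do rewrite -E1.
  by under [RHS]eq_integral do rewrite -E2; exact: Fubini.
Qed.


Section Integration.
Context {R : realType}.
Local Notation mu := (@lebesgue_measure R).
Implicit Types f g h F : R -> R.

(** Reflection preserves Lebesgue measure, so the integral equals its own opposite. This removes the
    sine part of the transform of an even function. *)
Lemma Rintegral_odd h : mu.-integrable setT (EFin \o h) ->
  (forall x, h (- x) = - h x) -> \int[mu]_x h x = 0.
Proof.
move=> ih oh; have mh : measurable_fun setT h.
  by apply/measurable_EFinP; case/integrableP: ih.
pose phi : measurableTypeR R -> measurableTypeR R := -%R.
have mphi : measurable_fun setT phi by exact: oppr_measurable.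
have ihN : mu.-integrable (phi @^-1` setT) ((EFin \o h) \o phi).
  rewrite preimage_setT (_ : _ \o phi = -%E \o (EFin \o h));
    first exact: integrableN.
  by apply/funext => x /=; rewrite oh EFinN.
have : \int[mu]_x h x = \int[mu]_x (- 1 * h x).
  rewrite /Rintegral; congr fine.
  transitivity (\int[pushforward mu phi]_x (EFin \o h) x)%E.
    by apply: eq_measure_integral => A mA _; apply/esym/lebesgue_measureN.
  rewrite (integral_pushforward mphi _ ihN)//.
    by rewrite preimage_setT; apply: eq_integral => x _ /=; rewrite oh mulN1r.
  exact/measurable_EFinP.
rewrite RintegralZl// mulN1r => /eqP.
by rewrite -addr_eq0 -mulr2n mulrn_eq0 => /eqP.
Qed.

(** [F] has to be a primitive on the positive half-line only: the integrands to come are written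
    with |x|, their primitives with x. *)
Lemma integral_even_FTC2 f F (l : R) :
  (forall x, 0 <= f x) -> continuous f -> f =1 f \o -%R ->
  (forall x : R, 0 < x -> is_derive x 1 F (f x)) -> {for 0, continuous F} ->
  F x @[x --> +oo] --> l ->
  (\int[mu]_x (f x)%:E = (2 * (l - F 0))%:E)%E.
Proof.
move=> f0 cf ef dF cF Fl.
rewrite ge0_symfun_integralT// -set_itvcy.
rewrite (@ge0_continuous_FTC2y _ f F 0 l)//.
- exact: continuous_subspaceT.
- by move=> x x0; have [] := dF _ x0.
- exact: cvg_at_right_filter.
- move=> x; rewrite in_itv/= andbT => x0.
  by rewrite derive1E; apply: derive_val; exact: dF.
Qed.

Lemma integrable_ge0 f (r : R) : continuous f -> (forall x, 0 <= f x) ->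
  (\int[mu]_x (f x)%:E = r%:E)%E -> mu.-integrable setT (EFin \o f).
Proof.
move=> cf f0 fr; apply/integrableP; split.
  by apply/measurable_EFinP; exact: continuous_measurable_fun.
under eq_integral do rewrite /= ger0_norm//.
by rewrite fr ltry.
Qed.

Lemma continuous_oneDsqr_inv : continuous (fun x : R => (1 + x ^+ 2)^-1).
Proof.
move=> x; apply: cvgV; first by rewrite gt_eqF// ltr_wpDr ?sqr_ge0.
by apply: cvgD; [exact: cvg_cst|exact: exprn_continuous].
Qed.

Lemma integral_oneDsqr_inv : (\int[mu]_x ((1 + x ^+ 2)^-1)%:E = pi%:E)%E.
Proof.
rewrite (@integral_even_FTC2 _ atan (pi / 2)).
- by rewrite atan0; congr EFin; field.
- by move=> x; rewrite invr_ge0 addr_ge0// sqr_ge0.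
- exact: continuous_oneDsqr_inv.
- by move=> x /=; rewrite sqrrN.
- exact: continuous_atan.
- exact: cvgy_atan.
Qed.

Lemma integrable_oneDsqr_inv :
  mu.-integrable setT (EFin \o fun x : R => (1 + x ^+ 2)^-1).
Proof.
apply: (integrable_ge0 _ _ integral_oneDsqr_inv).
  exact: continuous_oneDsqr_inv.
by move=> x; rewrite invr_ge0 addr_ge0// sqr_ge0.
Qed.

End Integration.

(** * Lorentzians and their Fourier transform *)

Section Derivation.
Context {R : realType}.
Implicit Types (f g : R -> R) (x a b c : R).

Lemma is_derive_weaken f x a b : is_derive x 1 f a -> a = b ->
  is_derive x 1 f b.
Proof. by move=> df <-. Qed.

Lemma is_derive_addf f g x a b : is_derive x 1 f a -> is_derive x 1 g b ->
  is_derive x 1 (fun y => f y + g y) (a + b).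
Proof. by move=> df dg; exact: is_deriveD. Qed.

Lemma is_derive_oppf f x a : is_derive x 1 f a ->
  is_derive x 1 (fun y => - f y) (- a).
Proof. by move=> df; exact: is_deriveN. Qed.

Lemma is_derive_mulf f g x a b : is_derive x 1 f a -> is_derive x 1 g b ->
  is_derive x 1 (fun y => f y * g y) (f x * b + g x * a).
Proof. by move=> df dg; exact: is_deriveM. Qed.

Lemma is_derive_invf f x a : f x != 0 -> is_derive x 1 f a ->
  is_derive x 1 (fun y => (f y)^-1) (- (f x) ^- 2 * a).
Proof. by move=> f0 df; exact: is_deriveV. Qed.

Lemma is_derive_expf f n x a : is_derive x 1 f a ->
  is_derive x 1 (fun y => f y ^+ n) (n%:R * f x ^+ n.-1 * a).
Proof.
move=> df; have -> : (fun y => f y ^+ n) = f ^+ n by rewrite exprfctE.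
exact: is_deriveX.
Qed.

Lemma is_derive_expRf f x a : is_derive x 1 f a ->
  is_derive x 1 (fun y => expR (f y)) (expR (f x) * a).
Proof. by move=> df; apply: (is_derive1_comp (is_derive_expR _) df). Qed.

Lemma is_derive_sinf f x a : is_derive x 1 f a ->
  is_derive x 1 (fun y => sin (f y)) (cos (f x) * a).
Proof. by move=> df; apply: (is_derive1_comp (is_derive_sin _) df). Qed.

Lemma is_derive_cosf f x a : is_derive x 1 f a ->
  is_derive x 1 (fun y => cos (f y)) (- sin (f x) * a).
Proof. by move=> df; apply: (is_derive1_comp (is_derive_cos _) df). Qed.

Lemma is_derive_lnf f x a : 0 < f x -> is_derive x 1 f a ->
  is_derive x 1 (fun y => ln (f y)) ((f x)^-1 * a).
Proof. by move=> f0 df; apply: (is_derive1_comp (is_derive1_ln f0) df). Qed.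

Lemma is_derive_mulr c x : is_derive x 1 ( *%R c) c.
Proof.
have := is_derive_mulf (is_derive_cst c x 1) (is_derive_id x 1).
by rewrite mulr1 mulr0 addr0.
Qed.

Lemma is_derive_opp x : is_derive x 1 -%R (- 1).
Proof. exact: is_derive_oppf (is_derive_id x 1). Qed.

Lemma is_derive_addr c x : is_derive x 1 (+%R c) 1.
Proof.
have := is_derive_addf (is_derive_cst c x 1) (is_derive_id x 1).
by rewrite add0r.
Qed.

Lemma is_derive_continuous f x a : is_derive x 1 f a -> {for x, continuous f}.
Proof.
by move=> [df _]; apply: differentiable_continuous; exact/derivable1_diffP.
Qed.

End Derivation.

Section Continuity.
Context {R : realType}.
Implicit Types (f g : R -> R) (x c : R).

Lemma continuous_addf f g : continuous f -> continuous g ->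
  continuous (fun y => f y + g y).
Proof. by move=> cf cg x; exact: cvgD (cf x) (cg x). Qed.

Lemma continuous_oppf f : continuous f -> continuous (fun y => - f y).
Proof. by move=> cf x; exact: cvgN (cf x). Qed.

Lemma continuous_mulf f g : continuous f -> continuous g ->
  continuous (fun y => f y * g y).
Proof. by move=> cf cg x; exact: cvgM (cf x) (cg x). Qed.

Lemma continuous_invf f : (forall x, f x != 0) -> continuous f ->
  continuous (fun y => (f y)^-1).
Proof. by move=> f0 cf x; exact: cvgV (f0 x) (cf x). Qed.

Lemma continuous_expf f n : continuous f -> continuous (fun y => f y ^+ n).
Proof.
move=> cf x; apply: (@continuous_comp _ _ _ f (fun z => z ^+ n)) (cf x) _.
exact: exprn_continuous.
Qed.

Lemma continuous_normf f : continuous f -> continuous (fun y => `|f y|).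
Proof. by move=> cf x; exact: cvg_norm (cf x). Qed.

Lemma continuous_expRf f : continuous f -> continuous (fun y => expR (f y)).
Proof. by move=> cf x; apply: (continuous_comp (cf x));
  exact: continuous_expR. Qed.

Lemma continuous_cosf f : continuous f -> continuous (fun y => cos (f y)).
Proof. by move=> cf x; apply: (continuous_comp (cf x));
  exact: continuous_cos. Qed.

Lemma continuous_sinf f : continuous f -> continuous (fun y => sin (f y)).
Proof. by move=> cf x; apply: (continuous_comp (cf x));
  exact: continuous_sin. Qed.

Lemma continuous_idf : continuous (fun y : R => y).
Proof. by move=> x; exact: cvg_id. Qed.

Lemma continuous_mulr c : continuous ( *%R c).
Proof. by move=> x; apply: cvgMr; exact: cvg_id. Qed.

Lemma continuous_addr c : continuous (+%R c).
Proof. by move=> x; apply: cvgD; [exact: cvg_cst|exact: cvg_id]. Qed.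

Lemma continuous_cstf c : continuous (fun _ : R => c).
Proof. by move=> x; exact: cvg_cst. Qed.

End Continuity.

Ltac derive_step :=
  match goal with
  | H : is_derive ?x _ ?f _ |- is_derive ?x _ ?f _ => exact: H
  | |- is_derive _ _ (fun y => y) _ => exact: is_derive_id
  | |- is_derive _ _ ( *%R _) _ => exact: is_derive_mulr
  | |- is_derive _ _ -%R _ => exact: is_derive_opp
  | |- is_derive _ _ (+%R _) _ => exact: is_derive_addr
  | |- is_derive _ _ (fun _ => ?c) _ => exact: is_derive_cst
  | |- is_derive _ _ (fun _ => _ + _) _ => notypeclasses refine (is_derive_addf
    _ _)
  | |- is_derive _ _ (fun _ => - _) _ => notypeclasses refine (is_derive_oppf _)
  | |- is_derive _ _ (fun _ => _ * _) _ => notypeclasses refine (is_derive_mulf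
    _ _)
  | |- is_derive _ _ (fun _ => _ ^-1) _ => notypeclasses refine (is_derive_invf
    _ _)
  | |- is_derive _ _ (fun _ => _ ^+ _) _ => notypeclasses refine
    (is_derive_expf _ _)
  | |- is_derive _ _ (fun _ => expR _) _ => notypeclasses refine
    (is_derive_expRf _)
  | |- is_derive _ _ (fun _ => sin _) _ => notypeclasses refine (is_derive_sinf
    _)
  | |- is_derive _ _ (fun _ => cos _) _ => notypeclasses refine (is_derive_cosf
    _)
  | |- is_derive _ _ (fun _ => ln _) _ => notypeclasses refine (is_derive_lnf _
    _)
  end.
(** [is_derive] is a class: [notypeclasses refine] keeps instance search away from the premises. The
    derivative is computed by the rules and then compared with the expected one, side conditions on
    denominators and logarithms being left open. *)
Ltac derive_tac := notypeclasses refine (is_derive_weaken _ _);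
  [repeat derive_step..|cbv beta].

Ltac continuous_step :=
  match goal with
  | H : continuous ?f |- continuous ?f => exact: H
  | |- continuous (fun y => y) => exact: continuous_idf
  | |- continuous ( *%R _) => exact: continuous_mulr
  | |- continuous (+%R _) => exact: continuous_addr
  | |- continuous (fun _ => ?c) => exact: continuous_cstf
  | |- continuous (fun _ => _ + _) => apply: continuous_addf
  | |- continuous (fun _ => - _) => apply: continuous_oppf
  | |- continuous (fun _ => _ * _) => apply: continuous_mulf
  | |- continuous (fun _ => _ ^-1) => apply: continuous_invf
  | |- continuous (fun _ => _ ^+ _) => apply: continuous_expf
  | |- continuous (fun _ => `|_|) => apply: continuous_normf
  | |- continuous (@Num.norm _ _) => apply: norm_continuous
  | |- continuous (fun _ => expR _) => apply: continuous_expRf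
  | |- continuous (fun _ => sin _) => apply: continuous_sinf
  | |- continuous (fun _ => cos _) => apply: continuous_cosf
  end.
Ltac continuous_tac := repeat continuous_step.

(** * Lorentzians and their cosine integrals *)

Section Lorentzian.
Context {R : realType}.
Local Notation mu := (@lebesgue_measure R).
Implicit Types (b c d x y : R).

(* c P_b - d (dP_b/db), where P_b = 2b / (b^2 + x^2) has Fourier transform
   2 pi e^{-b|y|}. *)
Definition lorentz c d b x : R :=
  2 * (c * b / (b ^+ 2 + x ^+ 2)
     + d * (b ^+ 2 - x ^+ 2) / (b ^+ 2 + x ^+ 2) ^+ 2).

(** The Fourier transform of [lorentz c d b] divided by 2 pi: differentiating -e^{-b|y|} in b brings
    down the factor |y|. *)
Definition lorentz_hat c d b y : R := (c + d * `|y|) * expR (- b * `|y|).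

Lemma sqrD_gt0 b x : 0 < b -> 0 < b ^+ 2 + x ^+ 2.
Proof. by move=> b0; rewrite ltr_wpDr ?sqr_ge0// exprn_gt0. Qed.

Lemma cvg0_mul_bounded (f g : R -> R) (K : R) :
  f y @[y --> +oo] --> 0 -> (\forall y \near +oo, `|g y| <= K) ->
  (f y * g y) @[y --> +oo] --> 0.
Proof.
move=> f0 gK.
apply/norm_cvg0P; apply: (@squeeze_cvgr _ _ _ _ (cst 0) (fun y => `|f y| * K)).
- near=> y; rewrite normr_ge0/= normrM ler_wpM2l//; near: y; exact: gK.
- exact: cvg_cst.
- rewrite -(mul0r K); apply: cvgMl; exact/norm_cvg0P.
Unshelve. all: by end_near. Qed.

Lemma cvg_expR_linear0 b : 0 < b -> expR (- b * y) @[y --> +oo] --> 0.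
Proof.
move=> b0.
have -> : (fun y => expR (- b * y)) = (fun y => expR (- y)) \o (fun y => b * y).
  by apply/funext => y /=; rewrite mulNr.
apply: (cvg_comp _ _ _ (@cvgr_expR R)).
apply: gt0_cvgMry => //; exact: cvg_id.
Qed.

Lemma mulr_expRN_le b y : 0 < b -> y * expR (- b * y) <= b^-1.
Proof.
move=> b0; rewrite mulNr expRN ler_pdivrMr ?expR_gt0// mulrC ler_pdivlMr//.
by rewrite mulrC (le_trans _ (expR_ge1Dx _))// lerDr.
Qed.

Lemma cvg_mulr_expR_linear0 b :
  0 < b -> (y * expR (- b * y)) @[y --> +oo] --> 0.
Proof.
move=> b0; have b20 : 0 < b / 2 by rewrite divr_gt0.
(* Half of the exponential keeps y bounded, the other half tends to 0. *)
have -> : (fun y => y * expR (- b * y)) =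
    (fun y => expR (- (b / 2) * y) * (y * expR (- (b / 2) * y))).
  by apply/funext => y; rewrite mulrCA -expRD; congr (_ * expR _); field.
apply: (@cvg0_mul_bounded _ _ (b / 2)^-1); first exact: cvg_expR_linear0.
near=> y; rewrite ger0_norm ?mulr_expRN_le//.
by rewrite mulr_ge0 ?expR_ge0//; near: y; exact: nbhs_pinfty_ge.
Unshelve. all: by end_near. Qed.

(** With z = b - ix, this is the real part of -e^{-zy} ((c + dy)/z + d/z^2), a primitive in y of (c
    + dy) e^{-zy}. *)
Definition lorentz_primitive c d b x y : R := expR (- b * y) *
  ((c + d * y) * ((x * sin (x * y) - b * cos (x * y)) / (b ^+ 2 + x ^+ 2))
   - d * (((b ^+ 2 - x ^+ 2) * cos (x * y) - 2 * b * x * sin (x * y))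
          / (b ^+ 2 + x ^+ 2) ^+ 2)).

Lemma is_derive_lorentz_primitive c d b x y : 0 < b ->
  is_derive y 1 (lorentz_primitive c d b x)
    ((c + d * y) * expR (- b * y) * cos (x * y)).
Proof.
move=> b0; rewrite /lorentz_primitive; derive_tac.
by field; rewrite gt_eqF// sqrD_gt0.
Qed.

Lemma cvg_lorentz_primitive c d b x :
  0 < b -> lorentz_primitive c d b x y @[y --> +oo] --> 0.
Proof.
move=> b0; set D := b ^+ 2 + x ^+ 2.
have -> : lorentz_primitive c d b x = (fun y =>
   (c * expR (- b * y) + d * (y * expR (- b * y))) *
     ((x * sin (x * y) - b * cos (x * y)) / D) +
   expR (- b * y) * (- d * (((b ^+ 2 - x ^+ 2) * cos (x * y)
     - 2 * b * x * sin (x * y)) / D ^+ 2))).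
  by apply/funext => y; rewrite /lorentz_primitive -/D; ring.
have le2 (p q y : R) : `|p * sin (x * y) - q * cos (x * y)| <= `|p| + `|q|.
  rewrite (le_trans (ler_normB _ _))// lerD// normrM ler_piMr//.
    exact: sin_max.
  exact: cos_max.
rewrite -[0 in X in _ --> X]addr0; apply: cvgD.
  apply: (@cvg0_mul_bounded _ _ ((`|x| + `|b|) * `|D^-1|)).
    rewrite -[0 in X in _ --> X]addr0; apply: cvgD.
      by rewrite -(mulr0 c); apply: cvgMr; exact: cvg_expR_linear0.
    by rewrite -(mulr0 d); apply: cvgMr; exact: cvg_mulr_expR_linear0.
  by near=> y; rewrite normrM ler_wpM2r.
apply: (@cvg0_mul_bounded _ _ (`|d| * ((`|b ^+ 2 - x ^+ 2| + `|2 * b * x|) *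
  `|D ^- 2|))).
  exact: cvg_expR_linear0.
apply: nearW => y; rewrite normrM normrN ler_wpM2l// normrM ler_wpM2r//.
rewrite (le_trans (ler_normB _ _))// lerD// normrM ler_piMr//.
  exact: cos_max.
exact: sin_max.
Unshelve. all: by end_near. Qed.

Lemma continuous_lorentz_hat c d b : continuous (lorentz_hat c d b).
Proof.
by rewrite /lorentz_hat; continuous_tac.
Qed.

Lemma lorentz_hat_ge0 c d b y : 0 <= c -> 0 <= d -> 0 <= lorentz_hat c d b y.
Proof. by move=> c0 d0; rewrite mulr_ge0 ?expR_ge0// addr_ge0// mulr_ge0. Qed.

Lemma lorentz_hat_le c d b y : 0 <= c -> 0 <= d -> 0 < b ->
  lorentz_hat c d b y <= c + d / b.
Proof.
move=> c0 d0 b0; rewrite /lorentz_hat mulrDl lerD//.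
  rewrite ler_piMr// -expR0 ler_expR mulNr oppr_le0 mulr_ge0// ltW//.
by rewrite -mulrA ler_wpM2l// mulr_expRN_le.
Qed.

(* Adding 1 to the cosine makes the integrand nonnegative, so that its improper
   integral is given by the fundamental theorem of calculus. *)
Lemma integral_lorentz_hat1D c d b x : 0 < b -> 0 <= c -> 0 <= d ->
  (\int[mu]_y (lorentz_hat c d b y * (1 + cos (x * y)))%:E =
   (lorentz c d b 0 + lorentz c d b x)%:E)%E.
Proof.
move=> b0 c0 d0.
pose F (y : R) := lorentz_primitive c d b 0 y + lorentz_primitive c d b x y.
have dF (y : R) : 0 < y ->
  is_derive y 1 F (lorentz_hat c d b y * (1 + cos (x * y))).
  move=> y0; have := is_derive_lorentz_primitive c d 0 y b0.
  have := is_derive_lorentz_primitive c d x y b0.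
  move=> d1 d2; rewrite /F; derive_tac.
  by rewrite /lorentz_hat (gtr0_norm y0) mul0r cos0; ring.
rewrite (@integral_even_FTC2 _ _ F 0 _ _ _ dF).
- congr EFin; rewrite /F /lorentz_primitive /lorentz !mulr0 expR0 sin0 cos0;
  field.
  by rewrite (gt_eqF b0) (gt_eqF (sqrD_gt0 _ _)).
- move=> y; rewrite mulr_ge0 ?lorentz_hat_ge0//.
- by have := @continuous_lorentz_hat c d b => ?; continuous_tac.
- by move=> y /=; rewrite /lorentz_hat normrN mulrN cosN.
- apply: (is_derive_continuous (is_derive_addf (is_derive_lorentz_primitive _ _
  _ _ b0) (is_derive_lorentz_primitive _ _ _ _ b0))).
- rewrite -[0 in X in _ --> X]addr0; apply: cvgD; exact: cvg_lorentz_primitive.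
Qed.

Lemma integrable_lorentz_hat c d b : 0 < b -> 0 <= c -> 0 <= d ->
  mu.-integrable setT (EFin \o lorentz_hat c d b).
Proof.
move=> b0 c0 d0; apply: (@integrable_ge0 _ _ (lorentz c d b 0)).
- exact: continuous_lorentz_hat.
- by move=> y; exact: lorentz_hat_ge0.
(* At x = 0 the factor 1 + cos is the constant 2. *)
- have := integral_lorentz_hat1D 0 b0 c0 d0.
  under eq_integral do rewrite mul0r cos0 -mulr2n mulrC EFinM.
  rewrite ge0_integralZl//; last 2 first.
  + by apply/measurable_EFinP; apply: continuous_measurable_fun;
    exact: continuous_lorentz_hat.
  + by move=> y _; rewrite lee_fin lorentz_hat_ge0.
  + move=> /(congr1 (fun z => (2^-1)%:E * z)%E).
    rewrite muleA -!EFinM mulVf// mul1e => ->; congr EFin; lra.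
Qed.

Lemma Rintegral_lorentz_hat_cos c d b x : 0 < b -> 0 <= c -> 0 <= d ->
  \int[mu]_y (lorentz_hat c d b y * cos (x * y)) = lorentz c d b x.
Proof.
move=> b0 c0 d0; have im := integrable_lorentz_hat b0 c0 d0.
have H z :
  mu.-integrable setT (EFin \o fun y => lorentz_hat c d b y * cos (z * y)).
  apply: (integrable_le _ (integrable_norm im)) => [|y].
    apply: continuous_measurable_fun.
    by have := @continuous_lorentz_hat c d b => ?; continuous_tac.
  by rewrite normrM ler_piMr// cos_max.
have E z : \int[mu]_y lorentz_hat c d b y + \int[mu]_y (lorentz_hat c d b y *
  cos (z * y))
   = lorentz c d b 0 + lorentz c d b z.
  have := integral_lorentz_hat1D z b0 c0 d0.
  move=> /(congr1 fine) /= <-; rewrite -RintegralD//.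
  by apply: eq_Rintegral => y _; rewrite mulrDr mulr1.
(* The case x = 0 gives the integral without cosine, which is subtracted to remove the added 1. *)
have := E x; have := E 0; clear E H im.
under [X in _ + X = _ -> _]eq_Rintegral do rewrite mul0r cos0 mulr1.
have alg (I J A B : R) : I + I = A + A -> I + J = A + B -> J = B by lra.
exact: alg.
Qed.

(** The constant depends on the lower bound [b0] only, so a single multiple of 1/(1 + x^2) dominates
    Lorentzian kernels of varying width. *)
Lemma sqrD_inv_le b0 b x : 0 < b0 -> b0 <= b ->
  (b ^+ 2 + x ^+ 2)^-1 <= (1 + b0 ^- 2) * (1 + x ^+ 2)^-1.
Proof.
move=> b00 bb; have b1 := lt_le_trans b00 bb.
have x1 : 0 < 1 + x ^+ 2 by rewrite ltr_wpDr ?sqr_ge0.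
rewrite -div1r ler_pdivrMr ?sqrD_gt0// mulrAC ler_pdivlMr// mul1r.
rewrite mulrDl mul1r mulrDr addrACA -[leLHS]addr0 addrC.
have h1 : 1 <= b0 ^- 2 * b ^+ 2.
  by rewrite mulrC ler_pdivlMr ?exprn_gt0// mul1r lerXn2r// nnegrE ltW.
have h2 : 0 <= b0 ^- 2 * x ^+ 2 by rewrite mulr_ge0 ?sqr_ge0// invr_ge0 sqr_ge0.
have := sqr_ge0 b; move: h1 h2; set p := b0 ^- 2 * b ^+ 2; set q :=
  b0 ^- 2 * x ^+ 2.
by move=> *; lra.
Qed.

Lemma lorentz_dominated c d b : 0 < b ->
  exists K : R, forall x, `|lorentz c d b x| <= K * (1 + x ^+ 2)^-1.
Proof.
move=> b0; exists (2 * (`|c| * b + `|d|) * (1 + b ^- 2)) => x.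
have A0 : 0 <= 2 * (`|c| * b + `|d|) by rewrite mulr_ge0// addr_ge0//
  mulr_ge0// ltW.
apply: (@le_trans _ _ (2 * (`|c| * b + `|d|) * (b ^+ 2 + x ^+ 2)^-1));
  last first.
  by rewrite -[leRHS]mulrA ler_wpM2l// sqrD_inv_le.
have D0 := sqrD_gt0 x b0; set D := b ^+ 2 + x ^+ 2.
rewrite /lorentz -/D normrM (ger0_norm (ler0n _ 2)) -[leRHS]mulrA ler_wpM2l//.
rewrite (le_trans (ler_normD _ _))// mulrDl lerD//.
  by rewrite !normrM (gtr0_norm b0) normfV (gtr0_norm D0).
rewrite !normrM normfV -mulrA ler_wpM2l// normrX (gtr0_norm D0).
rewrite ler_pdivrMr ?exprn_gt0// expr2 mulKf ?gt_eqF//.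
by rewrite (le_trans (ler_normB _ _))// !ger0_norm ?sqr_ge0.
Qed.

Lemma continuous_lorentz c d b : 0 < b -> continuous (lorentz c d b).
Proof.
move=> b0; rewrite /lorentz; continuous_tac.
- by move=> x; rewrite gt_eqF// sqrD_gt0.
- by move=> x; rewrite gt_eqF// exprn_gt0// sqrD_gt0.
Qed.

Lemma integrable_lorentz c d b : 0 < b -> mu.-integrable setT (EFin \o lorentz
  c d b).
Proof.
move=> b0; have [K dK] := lorentz_dominated c d b0.
have ig : mu.-integrable setT (EFin \o fun x => K * (1 + x ^+ 2)^-1).
  exact: (integrableZl measurableT K integrable_oneDsqr_inv).
apply: (integrable_le _ ig) => //.
by apply: continuous_measurable_fun; exact: continuous_lorentz.
Qed.

Lemma Rintegral_dominated_cvg (f_ : nat -> R -> R) (f g : R -> R) :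
  (forall n, measurable_fun setT (f_ n)) -> measurable_fun setT f ->
  mu.-integrable setT (EFin \o g) ->
  (forall x, f_ n x @[n --> \oo] --> f x) ->
  (forall n x, `|f_ n x| <= g x) ->
  \int[mu]_x f_ n x @[n --> \oo] --> \int[mu]_x f x.
Proof.
move=> mf_ mf ig cf fg.
have [|||||iff _ H] := @dominated_convergence _ _ _ mu setT measurableT
  (fun n x => (f_ n x)%:E) (EFin \o f) (EFin \o g).
- by move=> n; apply/measurable_EFinP; exact: mf_.
- by apply/measurable_EFinP.
- by apply: nearW => x _ /=; apply: cvg_EFin; [exact: nearW|exact: cf].
- exact: ig.
- by apply: nearW => x n _; rewrite lee_fin.
apply: fine_cvg; rewrite /Rintegral fineK; first exact: H.
exact: (integrable_fin_num measurableT).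
Qed.

(** [lorentz 1 0 del] is 2 pi times the Poisson kernel, an approximate identity as del tends to 0.
    The substitution z = y + del s turns it into the fixed density 2/(1 + s^2), of mass 2 pi;
    dominated convergence applies because [lorentz_hat] is bounded by c + d/b. *)
Lemma Rintegral_lorentz_conv c d (y : R) : 0 <= c -> 0 <= d -> forall b,
  0 < b ->
  forall del : nat -> R, (forall n, 0 < del n) -> del n @[n --> \oo] --> 0 ->
  \int[mu]_z (lorentz 1 0 (del n) (z - y) * lorentz_hat c d b z) @[n --> \oo]
    -->
  2 * pi * lorentz_hat c d b y.
Proof.
move=> c0 d0 b b0 del del0 cdel.
have chat := @continuous_lorentz_hat c d b.
have mhat := continuous_measurable_fun chat.
have E n : \int[mu]_z (lorentz 1 0 (del n) (z - y) * lorentz_hat c d b z) =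
    \int[mu]_s (2 * (1 + s ^+ 2)^-1 * lorentz_hat c d b (y + del n * s)).
  rewrite /Rintegral; congr fine.
  have dF : derive1 (fun s : R => y + del n * s) = cst (del n).
    apply/funext => s; rewrite derive1E; apply: derive_val.
    by derive_tac; rewrite add0r.
  rewrite (@increasing_ge0_integration_by_substitutionT _ (fun s =>
    y + del n * s))//.
  - apply: eq_integral => s _; rewrite [LHS](_ : _ = (lorentz 1 0 (del n)
        (y + del n * s - y) * lorentz_hat c d b (y + del n * s) * del n)%:E);
          last first.
      by rewrite !fctE dF.
    rewrite /lorentz [_ - y]addrC addKr; congr EFin; field.
    by rewrite gt_eqF ?ltr_wpDr ?sqr_ge0//= gt_eqF// sqrD_gt0.
  - by move=> s t st; rewrite ltrD2l ltr_pM2l.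
  - rewrite dF; exact: cst_continuous.
  - rewrite dF; exact: is_cvg_cst.
  - rewrite dF; exact: is_cvg_cst.
  - apply: (cvg_comp (fun s => del n * s) (fun s => y + s) _ (cvg_addrl_Ny y)).
    apply: gt0_cvgMrNy => //; exact: cvg_id.
  - apply: (cvg_comp (fun s => del n * s) (fun s => y + s) _ (cvg_addrl y)).
    apply: gt0_cvgMry => //; exact: cvg_id.
  - have := @continuous_lorentz 1 0 _ (del0 n) => cl.
    apply: continuous_mulf => // s; apply: (@continuous_comp _ _ _ (fun z => z
      - y) (lorentz 1 0 (del n))); last exact: cl.
    by apply: cvgB; [exact: cvg_id|exact: cvg_cst].
  - move=> s; rewrite mulr_ge0 ?lorentz_hat_ge0//.
    by rewrite /lorentz !mul0r addr0 mul1r !mulr_ge0 ?invr_ge0 ?ltW// sqrD_gt0.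
under eq_fun do rewrite E.
have -> : 2 * pi * lorentz_hat c d b y =
    \int[mu]_s (2 * (1 + s ^+ 2)^-1 * lorentz_hat c d b y).
  rewrite RintegralZr//; last exact: (integrableZl measurableT 2
    integrable_oneDsqr_inv).
  rewrite RintegralZl//; last exact: integrable_oneDsqr_inv.
  by rewrite /Rintegral integral_oneDsqr_inv.
apply: (@Rintegral_dominated_cvg _ _ (fun s => 2 * (1 + s ^+ 2)^-1 * (c + d /
  b))).
- move=> n; apply: continuous_measurable_fun.
  have := @continuous_oneDsqr_inv R => ?; apply: continuous_mulf;
    first by continuous_tac.
  have cF : continuous (fun s : R => y + del n * s) by continuous_tac.
  by move=> s; apply: (continuous_comp (cF s)); exact: chat.
- apply: continuous_measurable_fun.
  have := @continuous_oneDsqr_inv R => ?; continuous_tac.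
- exact: (integrableZr measurableT (c + d / b) (integrableZl measurableT 2
  integrable_oneDsqr_inv)).
- move=> s; apply: cvgMr.
  apply: (@continuous_cvg _ _ _ _ _ _ (lorentz_hat c d b)); first exact: chat.
  rewrite -[y in X in _ --> X]addr0 -(mul0r s); apply: cvgD;
    first exact: cvg_cst.
  exact: cvgMl.
- move=> n s; rewrite normrM ger0_norm ?ler_wpM2l ?mulr_ge0 ?invr_ge0 ?addr_ge0
  ?sqr_ge0//.
  by rewrite ger0_norm ?lorentz_hat_ge0// lorentz_hat_le.
Qed.

Lemma measurable_cosM y :
  measurable_fun setT (fun w : measurableTypeR R * measurableTypeR R =>
    (cos (y * w.1) * cos (w.1 * w.2) : R)).
Proof.
apply: measurable_funM.
  apply: (measurableT_comp (continuous_measurable_fun (@continuous_cos R))).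
  by apply: measurable_funM.
apply: (measurableT_comp (continuous_measurable_fun (@continuous_cos R))).
by apply: measurable_funM.
Qed.

(* Fourier inversion by Abel summation: insert the factor e^{-del|x|}, exchange
   the integrals, and let del tend to 0. *)
Let Rintegral_lorentz_cos0 c d b y : 0 <= c -> 0 <= d -> 0 < b ->
  \int[mu]_x (lorentz c d b x * cos (y * x)) = 2 * pi * lorentz_hat c d b y.
Proof.
move=> c0 d0 b0; pose del n : R := n.+1%:R^-1.
have del0 n : 0 < del n by rewrite invr_gt0.
have cdel : del n @[n --> \oo] --> 0 by exact: cvg_harmonic.
pose A n := \int[mu]_x (lorentz_hat 1 0 (del n) x * (cos (y * x) * lorentz c d
  b x)).
have cl := @continuous_lorentz c d b b0.
have il := integrable_lorentz c d b0.
have ihat := integrable_lorentz_hat b0 c0 d0.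
have H1 : A n @[n --> \oo] --> \int[mu]_x (lorentz c d b x * cos (y * x)).
  apply: (@Rintegral_dominated_cvg _ _ (fun x => `|lorentz c d b x|)).
  - move=> n; apply: continuous_measurable_fun.
    by have := @continuous_lorentz_hat 1 0 (del n) => ?; continuous_tac.
  - by apply: continuous_measurable_fun; continuous_tac.
  - exact: integrable_norm.
  - move=> x; rewrite (_ : lorentz c d b x * cos (y * x) = 1 * (cos (y * x) *
    lorentz c d b x)); last by ring.
    apply: cvgMl; rewrite (_ : (fun n => _) = fun n =>
      expR (- del n * `|x|)); last first.
      by apply/funext => n; rewrite /lorentz_hat mul0r addr0 mul1r.
    rewrite -expR0; apply: (@continuous_cvg _ _ _ _ _ _ expR);
      first exact: continuous_expR.
    by rewrite -(mul0r `|x|) -oppr0; apply: cvgMl; exact: cvgN.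
  - move=> n x; have h0 : 0 <= lorentz_hat 1 0 (del n) x by exact:
    lorentz_hat_ge0.
    rewrite normrM (ger0_norm h0) normrM mulrA ler_piMl// mulr_ile1//;
      last exact: cos_max.
    by rewrite (le_trans (lorentz_hat_le _ _ _ (del0 n)))// mul0r addr0.
pose J n z := \int[mu]_s (lorentz 1 0 (del n) (s - z) * lorentz_hat c d b s).
(* Write [lorentz] as the cosine integral of [lorentz_hat] and exchange the integrals. As 2 cos(yx)
   cos(xz) = cos((z - y)x) + cos((z + y)x), the inner integral of the damped cosines is a sum of two
   Poisson kernels. *)
have H2 n : A n = 2^-1 * (J n y + J n (- y)).
  have d1 := integrable_lorentz_hat (del0 n) ler01 (lexx 0).
  have cc (x z : R) : `|cos (y * x) * cos (x * z)| <= 1.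
    by rewrite normrM mulr_ile1// cos_max.
  have [_ _] := Fubini_bounded (T1 := measurableTypeR R) (T2 :=
    measurableTypeR R)
    (m1 := mu) (m2 := mu) (c := fun x z => cos (y * x) * cos (x * z)) d1 ihat
      (measurable_cosM y) cc.
  rewrite (_ : Rintegral _ _ _ = A n); last first.
    apply: eq_Rintegral => x _; congr (_ * _).
    rewrite -(Rintegral_lorentz_hat_cos x b0 c0 d0) -RintegralZl//; last first.
      apply: (integrable_le _ (integrable_norm ihat)) => [|z].
        apply: continuous_measurable_fun.
        by have := @continuous_lorentz_hat c d b => ?; continuous_tac.
      by rewrite normrM ler_piMr// cos_max.
    by apply: eq_Rintegral => z _; ring.
  move=> ->.
  have iL (z : R) : mu.-integrable setT (EFin \o fun s =>
    lorentz 1 0 (del n) (s - z) * lorentz_hat c d b s).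
    have [K HK] := lorentz_dominated 1 0 (del0 n).
    have iK : mu.-integrable setT (EFin \o fun s => K * `|lorentz_hat c d b s|).
      exact: (integrableZl measurableT K (integrable_norm ihat)).
    apply: (integrable_le _ iK) => [|s].
      apply: continuous_measurable_fun; apply: continuous_mulf;
        last exact: continuous_lorentz_hat.
      move=> s; apply: (@continuous_comp _ _ _ (fun s =>
        s - z) (lorentz 1 0 (del n))); last exact: continuous_lorentz.
      by apply: cvgB; [exact: cvg_id|exact: cvg_cst].
    rewrite normrM ler_wpM2r// (le_trans (HK _))// ler_piMr//.
      have := HK 0; rewrite expr0n addr0 invr1 mulr1; exact: le_trans.
    by rewrite invf_le1 ?lerDl ?sqr_ge0// ltr_wpDr ?sqr_ge0.
  rewrite /J -RintegralD// -RintegralZl//; last first.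
    exact: (integrableD measurableT (iL y) (iL (- y))).
  apply: eq_Rintegral => z _; rewrite -mulrDl mulrA; congr (_ * _).
  have icos (t : R) : mu.-integrable setT (EFin \o fun x =>
    lorentz_hat 1 0 (del n) x * cos (t * x)).
    apply: (integrable_le _ (integrable_norm d1)) => [|x].
      apply: continuous_measurable_fun.
      by have := @continuous_lorentz_hat 1 0 (del n) => ?; continuous_tac.
    by rewrite normrM ler_piMr// cos_max.
  rewrite -!(Rintegral_lorentz_hat_cos _ (del0 n) ler01 (lexx 0)).
  rewrite -RintegralD// -RintegralZl//; last first.
    exact: (integrableD measurableT (icos (z - y)) (icos (z - - y))).
  by apply: eq_Rintegral => x _; rewrite opprK mulrBl mulrDl cosB cosD (mulrC
    z); field.
have H3 : A n @[n --> \oo] --> 2 * pi * lorentz_hat c d b y.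
  under eq_fun do rewrite H2.
  rewrite (_ : 2 * pi * _ = 2^-1 * (2 * pi * lorentz_hat c d b y + 2 * pi *
    lorentz_hat c d b (- y))); last first.
    by rewrite {3}/lorentz_hat normrN -/(lorentz_hat c d b y); field.
  by apply: cvgMr; apply: cvgD; apply: Rintegral_lorentz_conv.
exact: (cvg_unique _ H1 H3).
Qed.

(** Linearity in c and d lifts the sign conditions, which came from the integration of nonnegative
    functions; amplitudes are negative when eps = -1. *)
Lemma Rintegral_lorentz_cos c d b y : 0 < b ->
  \int[mu]_x (lorentz c d b x * cos (y * x)) = 2 * pi * lorentz_hat c d b y.
Proof.
move=> b0.
have icos c' d' : mu.-integrable setT (EFin \o fun x =>
  lorentz c' d' b x * cos (y * x)).
  apply: (integrable_le _ (integrable_norm (integrable_lorentz c' d' b0))) =>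
    [|x].
    apply: continuous_measurable_fun.
    by have := @continuous_lorentz c' d' b b0 => ?; continuous_tac.
  by rewrite normrM ler_piMr// cos_max.
transitivity (c * \int[mu]_x (lorentz 1 0 b x * cos (y * x)) +
              d * \int[mu]_x (lorentz 0 1 b x * cos (y * x))).
  rewrite -!RintegralZl// -RintegralD//; last 2 first.
  - exact: (integrableZl measurableT c (icos 1 0)).
  - exact: (integrableZl measurableT d (icos 0 1)).
  by apply: eq_Rintegral => x _; rewrite /lorentz; ring.
by rewrite !Rintegral_lorentz_cos0// /lorentz_hat; ring.
Qed.

End Lorentzian.

(** * Tempered Fourier transforms and the action of the semigroup *)

Section FourierTransform.
Context {R : realType}.
Local Notation mu := (@lebesgue_measure R).
Local Open Scope complex_scope.
Implicit Types (a b c d t x y : R).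

(** The bounds with k = 0 and k = 2 on [psi] itself give (1 + x^2) |psi| <= C0 + C2. *)
Lemma integrable_schwartz (psi : R -> R) : schwartz psi ->
  mu.-integrable setT (EFin \o psi).
Proof.
move=> /(_ 0%N)[/= dpsi bpsi].
have [C0 b0] := bpsi 0%N; have [C2 b2] := bpsi 2%N.
have ig : mu.-integrable setT (EFin \o fun x : R =>
  (C0 + C2) * (1 + x ^+ 2)^-1).
  exact: (integrableZl measurableT (C0 + C2) integrable_oneDsqr_inv).
apply: (integrable_le _ ig) => [|x].
  apply: continuous_measurable_fun => x.
  by apply: differentiable_continuous; exact/derivable1_diffP.
rewrite ler_pdivlMr ?ltr_wpDr ?sqr_ge0// mulrDr mulr1 lerD//.
  by have := b0 x; rewrite expr0 mul1r.
by have := b2 x; rewrite normrM mulrC (ger0_norm (sqr_ge0 x)).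
Qed.

Let mulCc a (z : R[i]) : a%:C * z = (a * complex.Re z) +i* (a * complex.Im z).
Proof. by case: z => p q; congr Complex; rewrite /= mul0r ?subr0 ?addr0. Qed.

Let mulcC a (z : R[i]) : z * a%:C = (complex.Re z * a) +i* (complex.Im z * a).
Proof. by case: z => p q; congr Complex; rewrite /= mulr0 ?subr0 ?add0r. Qed.

Lemma fourier_integralE (psi : R -> R) x : fourier_integral psi x =
  (\int[mu]_y (psi y * cos (y * x))) +i* (\int[mu]_y (psi y * - sin (y * x))).
Proof.
by rewrite /fourier_integral /cintegral; congr Complex;
  apply: eq_Rintegral => y _; rewrite mulCc.
Qed.

Lemma measurable_cos_mul :
  measurable_fun setT (fun w : measurableTypeR R * measurableTypeR R =>
    (cos (w.2 * w.1) : R)).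
Proof.
apply: (measurableT_comp (continuous_measurable_fun (@continuous_cos R))).
by apply: measurable_funM.
Qed.

Lemma measurable_sin_mul :
  measurable_fun setT (fun w : measurableTypeR R * measurableTypeR R =>
    (- sin (w.2 * w.1) : R)).
Proof.
apply: measurableT_comp => //.
apply: (measurableT_comp (continuous_measurable_fun (@continuous_sin R))).
by apply: measurable_funM.
Qed.

(** The duality formula is Fubini with the cosine kernel for the real part and the sine kernel for
    the imaginary part. Evenness makes the sine integral of f vanish, which is why the transform is
    real. *)
Lemma is_fourier_even (f g : R -> R) :
  mu.-integrable setT (EFin \o f) -> (forall x, f (- x) = f x) ->
  (forall y, \int[mu]_x (f x * cos (y * x)) = g y) ->
  is_fourier f (fun y => (g y)%:C).
Proof.
move=> intf ef fg psi /integrable_schwartz ipsi.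
have c1 (x y : R) : `|cos (y * x)| <= 1 by exact: cos_max.
have s1 (x y : R) : `|- sin (y * x)| <= 1 by rewrite normrN sin_max.
have [I1 I2 I3] := Fubini_bounded (T1 := measurableTypeR R) (T2 :=
  measurableTypeR R)
  (m1 := mu) (m2 := mu) (c := fun x y => cos (y * x)) intf ipsi
    measurable_cos_mul c1.
have [J1 J2 J3] := Fubini_bounded (T1 := measurableTypeR R) (T2 :=
  measurableTypeR R)
  (m1 := mu) (m2 := mu) (c := fun x y => - sin (y * x)) intf ipsi
    measurable_sin_mul s1.
have mf : measurable_fun setT f by apply/measurable_EFinP;
  case/integrableP: intf.
have odd0 y : \int[mu]_x (f x * - sin (y * x)) = 0.
  apply: Rintegral_odd => [|x]; last by rewrite ef (mulrN y) sinN; ring.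
  apply: (integrable_le _ (integrable_norm intf)) => [|x]; last first.
    by rewrite normrM ler_piMr// normrN sin_max.
  apply: measurable_funM => //; apply: continuous_measurable_fun.
  by continuous_tac.
split.
- split.
  + by apply: eq_integrable I1 => // x _; apply: (congr1 EFin);
    rewrite mulCc fourier_integralE.
  + by apply: eq_integrable J1 => // x _; apply: (congr1 EFin);
    rewrite mulCc fourier_integralE.
- split.
  + by apply: eq_integrable I2 => // y _; apply: (congr1 EFin);
    rewrite mulcC/= fg.
  + by apply: eq_integrable J2 => // y _; apply: (congr1 EFin);
    rewrite mulcC/= odd0.
- rewrite /cintegral; congr Complex.
  + transitivity (\int[mu]_x (f x * \int[mu]_y (psi y * cos (y * x)))).
      by apply: eq_Rintegral => x _; rewrite mulCc fourier_integralE.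
    by rewrite I3; apply: eq_Rintegral => y _; rewrite mulcC/= fg.
  + transitivity (\int[mu]_x (f x * \int[mu]_y (psi y * - sin (y * x)))).
      by apply: eq_Rintegral => x _; rewrite mulCc fourier_integralE.
    by rewrite J3; apply: eq_Rintegral => y _; rewrite mulcC/= odd0.
Qed.

Lemma is_fourier_lorentz c d b : 0 < b ->
  is_fourier (lorentz c d b) (fun y => (2 * pi * lorentz_hat c d b y)%:C).
Proof.
move=> b0; apply: is_fourier_even.
- exact: integrable_lorentz.
- by move=> x; rewrite /lorentz sqrrN.
- by move=> y; exact: Rintegral_lorentz_cos.
Qed.

Lemma is_frac_heat_lorentz t c d b : 0 < b -> 0 <= t ->
  is_frac_heat t (lorentz c d b) (lorentz c d (b + t)).
Proof.
move=> b0 t0; exists (fun y => (2 * pi * lorentz_hat c d b y)%:C).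
  exact: is_fourier_lorentz.
rewrite (_ : (fun y => _) = fun y => (2 * pi * lorentz_hat c d (b + t) y)%:C).
  by apply: is_fourier_lorentz; rewrite ltr_wpDr.
apply/funext => y; rewrite mulCc/= mulr0; congr Complex.
rewrite /lorentz_hat (_ : - (b + t) * `|y| = - t * `|y| + - b * `|y|);
  last by ring.
by rewrite expRD; ring.
Qed.

Lemma lorentz_sqr a b x : 0 < b ->
  lorentz a 0 b x ^+ 2 = lorentz (a ^+ 2 / b) (a ^+ 2) b x.
Proof.
move=> b0; rewrite /lorentz; field.
by rewrite (gt_eqF b0) (gt_eqF (sqrD_gt0 _ b0)).
Qed.

End FourierTransform.

(** * The H^{-1/2} norm of a Lorentzian *)

Section Sobolev.
Context {R : realType}.
Local Notation mu := (@lebesgue_measure R).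
Local Open Scope complex_scope.
Implicit Types (a b e x y : R).

(** Integrand of the squared H^{-1/2} norm of [lorentz 1 0 b], divided by (2 pi)^2; the factor 2b
    comes from squaring e^{-b|y|}. *)
Definition sobolev_density b y : R :=
  (1 + `|y| ^+ 2) `^ (- 2^-1) * expR (- (2 * b) * `|y|).

Lemma sobolev_weight_le1 y : (1 + `|y| ^+ 2) `^ (- 2^-1) <= 1 :> R.
Proof.
rewrite -[leRHS](powRr0 (1 + `|y| ^+ 2)) ler_powR ?lerDl ?sqr_ge0//
  ?oppr_le0 ?invr_ge0.
Qed.

Lemma measurable_sobolev_density b : measurable_fun setT (sobolev_density b).
Proof.
apply: measurable_funM; last first.
  by apply: continuous_measurable_fun; continuous_tac.
apply: (measurableT_comp (measurable_powR _)).
by apply: continuous_measurable_fun; continuous_tac.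
Qed.

Lemma integrable_sobolev_density b : 0 < b ->
  mu.-integrable setT (EFin \o sobolev_density b).
Proof.
move=> b0.
have i1 : mu.-integrable setT (EFin \o lorentz_hat 1 0 (2 * b)).
  by apply: integrable_lorentz_hat; rewrite ?mulr_gt0.
apply: (integrable_le _ i1) => [|y]; first exact: measurable_sobolev_density.
rewrite ger0_norm ?mulr_ge0 ?powR_ge0 ?expR_ge0// /lorentz_hat mul0r addr0.
by rewrite ler_wpM2r ?expR_ge0// sobolev_weight_le1.
Qed.

Lemma is_sobolev_norm_lorentz a b : 0 < b ->
  is_sobolev_norm (- 2^-1) (lorentz a 0 b)
    (2 * pi * `|a| * Num.sqrt (\int[mu]_y sobolev_density b y)).
Proof.
move=> b0; exists (fun y => (2 * pi * lorentz_hat a 0 b y)%:C).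
have hE y : (1 + `|y| ^+ 2) `^ (- 2^-1) *
    (complex.Re (2 * pi * lorentz_hat a 0 b y)%:C ^+ 2 +
     complex.Im (2 * pi * lorentz_hat a 0 b y)%:C ^+ 2) =
    (2 * pi * a) ^+ 2 * sobolev_density b y.
  rewrite /= expr0n addr0 /sobolev_density /lorentz_hat mul0r addr0.
  rewrite (_ : - (2 * b) * `|y| = - b * `|y| + - b * `|y|); last by ring.
  by rewrite expRD; ring.
split.
- exact: is_fourier_lorentz.
- rewrite (_ : _ \o _ =
    EFin \o fun y => (2 * pi * a) ^+ 2 * sobolev_density b y).
    exact: (integrableZl measurableT ((2 * pi * a) ^+ 2)
      (integrable_sobolev_density b0)).
  by apply/funext => y /=; rewrite hE.
- transitivity (Num.sqrt
    (\int[mu]_y ((2 * pi * a) ^+ 2 * sobolev_density b y))); last first.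
    by congr Num.sqrt; apply: eq_Rintegral => y _; rewrite hE.
  rewrite RintegralZl//; last exact: integrable_sobolev_density.
  rewrite sqrtrM ?sqr_ge0// sqrtr_sqr normrM ger0_norm// mulr_ge0//.
  exact: pi_ge0.
Qed.

Lemma sobolev_weight_ge y : (1 + `|y| ^+ 2)^-1 <= (1 + `|y| ^+ 2) `^ (- 2^-1)
  :> R.
Proof.
have h : 1 <= 1 + `|y| ^+ 2 by rewrite lerDl sqr_ge0.
rewrite -[leLHS]powR_inv1 ?(le_trans ler01 h)// ler_powR//; lra.
Qed.

(** A rational majorant with the decay 1/|y| responsible for the logarithm; it amounts to (1 +
    |y|)^2 <= 4 (1 + y^2). *)
Lemma sobolev_weight_le y : (1 + `|y| ^+ 2) `^ (- 2^-1) <= 2 / (1 + `|y|) :> R.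
Proof.
have h : 0 < 1 + `|y| ^+ 2 by rewrite ltr_wpDr ?sqr_ge0.
have h1 : 0 < 1 + `|y| by rewrite ltr_wpDr.
rewrite powRN (powR12_sqrt (ltW h)) -[leRHS]invf_div lef_pV2 ?posrE ?divr_gt0
  ?sqrtr_gt0//.
rewrite -(ler_pXn2r (n := 2))// ?nnegrE ?sqrtr_ge0 ?divr_ge0 ?(ltW h1)//.
rewrite sqr_sqrtr ?(ltW h)//; have := sqr_ge0 (1 - `|y|); have :=
  sqr_ge0 (1 + `|y|).
by move: `|y| => z *; nra.
Qed.

(** On [0, 1] the weight is at least 1/2 and the exponential at least e^{-2e}. So crude a bound is
    enough: at the final time the growth comes from the amplitude, and the width need only be
    bounded above. *)
Lemma Rintegral_sobolev_density_ge b e : 0 < b -> b <= e ->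
  2^-1 * expR (- (2 * e)) <= \int[mu]_y sobolev_density b y.
Proof.
move=> b0 be; set k := _ * _.
have k0 : 0 <= k by rewrite mulr_ge0 ?invr_ge0 ?expR_ge0.
have i1 : mu.-integrable setT (EFin \o (\1_(`[0, 1]%classic) : R -> R)).
  exact: integrable_indic_itv.
rewrite (_ : k = \int[mu]_y (k * \1_(`[0, 1]%classic) y)); last first.
  have m1 : (mu `[0%R, 1%R]%classic = 1)%E.
    by rewrite lebesgue_measure_itv/= lte_fin ltr01 oppr0 adde0.
  rewrite RintegralZl// /Rintegral (integral_indic mu measurableT
    (measurable_itv _)).
  by rewrite setIT [X in fine X]m1 mulr1.
apply: le_Rintegral => //.
- exact: (integrableZl measurableT k i1).
- exact: integrable_sobolev_density.
move=> y _; rewrite indicE; have [y01|y01] := boolP (y \in `[0, 1]%classic);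
  last first.
  by rewrite mulr0 mulr_ge0 ?powR_ge0 ?expR_ge0.
move: y01; rewrite inE/= in_itv/= => /andP[y0 y1].
rewrite mulr1 ler_pM ?invr_ge0 ?expR_ge0//.
  apply: le_trans (sobolev_weight_ge y).
  rewrite lef_pV2 ?posrE ?ltr_wpDr ?sqr_ge0// ger0_norm//.
  by rewrite (_ : 2 = 1 + 1)// lerD2l expr_le1.
rewrite ler_expR mulNr lerN2 -[leRHS]mulr1 ger0_norm// ler_pM//.
  by rewrite mulr_ge0// ltW.
by rewrite ler_pM2l.
Qed.

(** The logarithmic growth for small b, stated with a lower bound [e] of 2b so that an [e] with an
    explicit logarithm can be chosen. *)
Lemma Rintegral_sobolev_density_le b e : 0 < e -> e < 1 -> e <= 2 * b ->
  \int[mu]_y sobolev_density b y <= 4 * - ln e / (1 - e).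
Proof.
move=> e0 e1 eb; have b0 : 0 < b by rewrite -(pmulr_rgt0 _ (ltr0n _ 2))
  (lt_le_trans e0).
(* e^{-2by} <= 1 / (1 + ey) yields a majorant with an explicit primitive. *)
pose q (y : R) : R := 2 * ((1 + `|y|)^-1 * (1 + e * `|y|)^-1).
have p1 (y : R) : 0 <= y -> 0 < 1 + y by move=> y0; rewrite ltr_wpDr.
have pe (y : R) : 0 <= y -> 0 < 1 + e * y by move=> y0; rewrite ltr_wpDr//
  mulr_ge0// ltW.
have cq : continuous q.
  rewrite /q; continuous_tac.
  - by move=> y; rewrite gt_eqF// p1.
  - by move=> y; rewrite gt_eqF// pe.
have q0 y : 0 <= q y.
  have h1 := ltW (p1 _ (normr_ge0 y)); have h2 := ltW (pe _ (normr_ge0 y)).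
  by rewrite !mulr_ge0 ?invr_ge0.
(* From the partial fractions (1 - e) / ((1 + y)(1 + ey)) = 1/(1 + y) - e/(1 + ey). *)
pose F (y : R) := 2 / (1 - e) * ln ((1 + y) / (1 + e * y)).
have dF (y : R) : 0 <= y -> is_derive y 1 F (q y).
  move=> y0; rewrite /F; derive_tac.
  - exact: divr_gt0 (p1 _ y0) (pe _ y0).
  - by rewrite gt_eqF// pe.
  - rewrite /q ger0_norm//; field.
    by rewrite (gt_eqF (p1 _ y0)) (gt_eqF (pe _ y0)) subr_eq0 gt_eqF.
have Fl : F y @[y --> +oo] --> 2 / (1 - e) * - ln e.
  apply: cvgMr; rewrite -lnV//; apply: (@continuous_cvg _ _ _ _ _ _ (@ln R)).
    by apply: continuous_ln; rewrite invr_gt0.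
  (* Division of 1 + y by 1 + ey exhibits the limit 1/e of the quotient. *)
  apply: cvg_trans (_ : (e^-1 + (1 - e^-1) * (1 + e * y)^-1) @[y --> +oo] -->
    _).
    apply: near_eq_cvg; near=> y.
    have y0 : 0 <= y by near: y; exact: nbhs_pinfty_ge.
    by field; rewrite (gt_eqF (pe _ y0)) gt_eqF.
  rewrite -[X in _ --> X]addr0; apply: cvgD; first exact: cvg_cst.
  rewrite -(mulr0 (1 - e^-1)); apply: cvgMr.
  apply/gtr0_cvgV0.
    near=> y; apply: pe; near: y; exact: nbhs_pinfty_ge.
  apply: (cvg_comp (fun s => e * s) (fun s => 1 + s) _ (cvg_addrl 1)).
  by apply: gt0_cvgMry => //; exact: cvg_id.
have iq : (\int[mu]_y (q y)%:E = (4 * - ln e / (1 - e))%:E)%E.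
  rewrite (@integral_even_FTC2 _ _ F _ q0 cq _ _ _ Fl).
  - rewrite /F mulr0 !addr0 divr1 ln1 mulr0 subr0; congr EFin; field.
    by rewrite subr_eq0 gt_eqF.
  - by move=> y /=; rewrite /q normrN.
  - by move=> y y0; apply: dF; exact: ltW.
  - exact: (is_derive_continuous (dF 0 (lexx 0))).
rewrite -[leRHS]/(fine (4 * - ln e / (1 - e))%:E) -iq -/(Rintegral mu setT q).
apply: le_Rintegral => //.
- exact: integrable_sobolev_density.
- exact: integrable_ge0 iq.
move=> y _; rewrite /q mulrA ler_pM ?powR_ge0 ?expR_ge0 ?sobolev_weight_le//.
rewrite mulNr expRN lef_pV2 ?posrE ?expR_gt0 ?pe//.
by rewrite (le_trans _ (expR_ge1Dx _))// lerD2l ler_wpM2r.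
Unshelve. all: by end_near. Qed.

End Sobolev.

(** * Families that are Lipschitz in time *)

Section LipschitzFamilies.
Context {R : realType}.
Implicit Types (T K m s t x : R) (f g : R -> R -> R) (om : R -> R).

(** One constant serves for the bound and for the Lipschitz estimate in time. The profile [om] is 1
    for coefficients depending on time, and 1/(1 + x^2) for families to be integrated in L^2. *)
Definition lip_family T om f := exists2 K : R, 0 <= K &
  forall s x, s \in `[0, T] -> `|f s x| <= K * om x /\
    forall t, t \in `[0, T] -> `|f s x - f t x| <= K * `|s - t| * om x.

Definition lorentz_weight x : R := (1 + x ^+ 2)^-1.

Lemma lorentz_weight_ge0 x : 0 <= lorentz_weight x.
Proof. by rewrite invr_ge0 addr_ge0 ?sqr_ge0. Qed.

Lemma lorentz_weight_le1 x : lorentz_weight x <= 1.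
Proof. by rewrite invf_le1 ?lerDl ?sqr_ge0// ltr_wpDr ?sqr_ge0. Qed.

Lemma lip_family_eq T om f g :
  (forall s x, s \in `[0, T] -> f s x = g s x) ->
  lip_family T om f -> lip_family T om g.
Proof.
move=> fg [K K0 fK]; exists K => // s x sT; rewrite -fg//.
have [H1 H2] := fK s x sT; split => // t tT; rewrite -fg//; exact: H2.
Qed.

Lemma lip_family_cst T c : lip_family T (fun=> 1) (fun _ _ => c).
Proof.
exists `|c| => // s x sT; rewrite mulr1; split=> // t _.
by rewrite subrr normr0 mulr1 mulr_ge0.
Qed.

Lemma lip_familyD T om f g : (forall x, 0 <= om x) ->
  lip_family T om f -> lip_family T om g ->
  lip_family T om (fun s x => f s x + g s x).
Proof.
move=> om0 [K K0 fK] [L L0 gL]; exists (K + L); first exact: addr_ge0.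
move=> s x sT; have [f1 f2] := fK s x sT; have [g1 g2] := gL s x sT.
split=> [|t tT]; first by rewrite (le_trans (ler_normD _ _))// mulrDl lerD.
rewrite opprD addrACA (le_trans (ler_normD _ _))// !mulrDl lerD//.
  exact: f2.
exact: g2.
Qed.

Lemma lip_familyM T om1 om2 f g :
  (forall x, 0 <= om1 x) -> (forall x, 0 <= om2 x) ->
  lip_family T om1 f -> lip_family T om2 g ->
  lip_family T (fun x => om1 x * om2 x) (fun s x => f s x * g s x).
Proof.
move=> om10 om20 [K K0 fK] [L L0 gL]; exists (2 * (K * L)).
  by rewrite !mulr_ge0.
move=> s x sT; have [f1 f2] := fK s x sT; have [g1 g2] := gL s x sT.
have KL : 0 <= K * om1 x * (L * om2 x) by rewrite !mulr_ge0.
have fg : `|f s x| * `|g s x| <= K * om1 x * (L * om2 x) by rewrite ler_pM.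
split=> [|t tT].
  rewrite normrM (le_trans fg)// [leRHS](_ : _ = 2 * (K * om1 x * (L * om2 x))).
    by rewrite mulr2n mulrDl mul1r lerDl.
  by ring.
have [g3 _] := gL t x tT.
rewrite (_ : _ - _ = f s x * (g s x - g t x) + (f s x - f t x) * g t x);
  last by ring.
rewrite (le_trans (ler_normD _ _))// !normrM.
rewrite [leRHS](_ : _ = K * om1 x * (L * `|s - t| * om2 x) +
  K * `|s - t| * om1 x * (L * om2 x)); last by ring.
by rewrite lerD// ler_pM ?f2 ?g2.
Qed.

Lemma lip_family_le T om1 om2 f : (forall x, om1 x <= om2 x) ->
  lip_family T om1 f -> lip_family T om2 f.
Proof.
move=> om12 [K K0 fK]; exists K => // s x sT; have [f1 f2] := fK s x sT.
split=> [|t tT]; first by rewrite (le_trans f1)// ler_wpM2l.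
by rewrite (le_trans (f2 t tT))// ler_wpM2l// mulr_ge0.
Qed.

Lemma lip_family_bounded T f g :
  lip_family T (fun=> 1) f -> lip_family T (fun=> 1) g ->
  lip_family T (fun=> 1) (fun s x => f s x * g s x).
Proof.
move=> lf lg; apply: (lip_family_le (om1 := fun=> 1 * 1)) => [x|].
  by rewrite mulr1.
exact: (lip_familyM (fun=> ler01) (fun=> ler01)).
Qed.

Lemma lip_family_weight T f g :
  lip_family T (fun=> 1) f -> lip_family T lorentz_weight g ->
  lip_family T lorentz_weight (fun s x => f s x * g s x).
Proof.
move=> lf lg; apply: (lip_family_le (om1 := fun x =>
  1 * lorentz_weight x)) => [x|].
  by rewrite mul1r.
exact: (lip_familyM (fun=> ler01) lorentz_weight_ge0).
Qed.

Lemma lip_family_weight1 T g :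
  lip_family T lorentz_weight g -> lip_family T (fun=> 1) g.
Proof. exact/lip_family_le/lorentz_weight_le1. Qed.

Lemma lip_family_derive T K (f df : R -> R) : 0 <= T ->
  (forall s, s \in `[0, T] -> is_derive s 1 f (df s)) ->
  (forall s, s \in `[0, T] -> `|df s| <= K) ->
  lip_family T (fun=> 1) (fun s _ => f s).
Proof.
move=> T0 fdf dfK.
have K0 : 0 <= K by rewrite (le_trans _ (dfK 0 _))// in_itv/= lexx.
have lt s t : s \in `[0, T] -> t \in `[0, T] -> s <= t ->
  `|f s - f t| <= K * `|s - t|.
  rewrite !in_itv/= => /andP[s0 sT] /andP[t0 tT] st.
  have sub x : x \in `[s, t] -> x \in `[0, T].
    rewrite !in_itv/= => /andP[sx xt].
    by rewrite (le_trans s0 sx) (le_trans xt tT).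
  have H1 x : x \in `]s, t[ -> is_derive x 1 f (df x).
    by move=> xst; apply/fdf/sub/subset_itv_oo_cc.
  have H2 : {within `[s, t], continuous f}.
    apply: derivable_within_continuous => x /sub xT.
    by have [] := fdf x xT.
  have [c cst e] := MVT_segment st H1 H2.
  by rewrite distrC e (distrC s) normrM ler_wpM2r// dfK// sub.
have lip s t : s \in `[0, T] -> t \in `[0, T] -> `|f s - f t| <= K * `|s - t|.
  move=> sT tT; have [st|/ltW ts] := leP s t; first exact: lt.
  by rewrite distrC (distrC s); exact: lt.
(* [|f 0| + K * T] bounds f, and K is its Lipschitz constant. *)
exists (`|f 0| + K * T + K); first by rewrite !addr_ge0 ?mulr_ge0.
move=> s x sT; rewrite mulr1; split=> [|t tT].
  have z0 : 0 \in `[0, T] by rewrite in_itv/= lexx.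
  rewrite -[f s](subrK (f 0)) (le_trans (ler_normD _ _))// addrC -addrA lerD2l.
  rewrite (le_trans (lip _ _ sT z0))// subr0.
  move: sT; rewrite in_itv/= => /andP[s0 sT]; rewrite ger0_norm//.
  by rewrite (le_trans (ler_wpM2l K0 sT))// lerDl.
by rewrite mulr1 (le_trans (lip _ _ sT tT))// ler_wpM2r// lerDr addr_ge0//
  mulr_ge0.
Qed.

Lemma lip_family_inv T m (f : R -> R) : 0 < m ->
  (forall s, s \in `[0, T] -> m <= f s) ->
  lip_family T (fun=> 1) (fun s _ => f s) ->
  lip_family T (fun=> 1) (fun s _ => (f s)^-1).
Proof.
move=> m0 mf [K K0 fK].
have f0 s : s \in `[0, T] -> 0 < f s by move=> sT;
  rewrite (lt_le_trans m0)// mf.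
have fV s : s \in `[0, T] -> `|(f s)^-1| <= m^-1.
  move=> sT; rewrite normfV gtr0_norm ?f0// lef_pV2 ?posrE ?f0//; exact: mf.
exists (m^-1 + K * (m^-1 * m^-1)).
  by rewrite addr_ge0 ?mulr_ge0 ?invr_ge0// ltW.
move=> s x sT; rewrite mulr1; split=> [|t tT].
  by rewrite (le_trans (fV s sT))// lerDl !mulr_ge0 ?invr_ge0// ltW.
rewrite (_ : _ - _ = (f t - f s) * ((f s)^-1 * (f t)^-1)); last first.
  by field; rewrite !gt_eqF ?f0.
have [_ /(_ t tT)] := fK s x sT; rewrite mulr1 => fst.
rewrite mulr1 normrM normrM (distrC (f t)).
apply: (@le_trans _ _ (K * `|s - t| * (m^-1 * m^-1))).
  by rewrite ler_pM// ler_pM// fV.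
by rewrite mulrAC ler_wpM2r// lerDr invr_ge0 ltW.
Qed.

(** A difference of kernels is the difference of the squared widths times the product of the
    kernels, hence of order (1 + x^2)^{-2}; one of the two weights is bounded by 1. *)
Lemma lip_family_kernel T m (be : R -> R) : 0 < m ->
  (forall s, s \in `[0, T] -> m <= be s) ->
  lip_family T (fun=> 1) (fun s _ => be s) ->
  lip_family T lorentz_weight (fun s x => (be s ^+ 2 + x ^+ 2)^-1).
Proof.
move=> m0 mbe [K K0 beK]; pose M := 1 + m ^- 2.
have M0 : 0 <= M by rewrite addr_ge0 ?invr_ge0 ?sqr_ge0.
have be0 s : s \in `[0, T] -> 0 < be s by move=> sT;
  rewrite (lt_le_trans m0)// mbe.
have kM s x : s \in `[0, T] ->
  `|(be s ^+ 2 + x ^+ 2)^-1| <= M * lorentz_weight x.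
  move=> sT; rewrite ger0_norm ?invr_ge0 ?(ltW (sqrD_gt0 x (be0 s sT)))//.
  by apply: sqrD_inv_le => //; exact: mbe.
exists (M + 2 * K * K * (M * M)); first by rewrite addr_ge0 ?mulr_ge0.
move=> s x sT; split=> [|t tT].
  rewrite (le_trans (kM s x sT))// ler_wpM2r ?lorentz_weight_ge0//.
  by rewrite lerDl !mulr_ge0.
rewrite (_ : _ - _ = (be t - be s) * (be t + be s) *
    ((be s ^+ 2 + x ^+ 2)^-1 * (be t ^+ 2 + x ^+ 2)^-1)); last first.
  by field; rewrite (gt_eqF (sqrD_gt0 x (be0 s sT)))
      (gt_eqF (sqrD_gt0 x (be0 t tT))).
have [+ /(_ s sT)] := beK t 0 tT; have [+ _] := beK s 0 sT.
rewrite !mulr1 => bs bt bts.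
have w0 := lorentz_weight_ge0 x; have w1 := lorentz_weight_le1 x.
rewrite normrM normrM normrM.
apply: (@le_trans _ _ (K * `|t - s| * (K + K) * (M * lorentz_weight x * (M *
  lorentz_weight x)))).
  rewrite ler_pM ?mulr_ge0//; last by rewrite ler_pM// kM.
  by rewrite ler_pM// (le_trans (ler_normD _ _))// lerD.
rewrite (distrC t) (_ : _ * _ * _ * _ = 2 * K * K * (M * M) * `|s - t| *
  lorentz_weight x * lorentz_weight x); last by ring.
rewrite (@le_trans _ _ (2 * K * K * (M * M) * `|s - t| * lorentz_weight x))//.
  by rewrite ler_piMr// !mulr_ge0.
by rewrite ler_wpM2r// ler_wpM2r// lerDr.
Qed.

Lemma lip_family_lorentz T m (c d be : R -> R) : 0 < m ->
  (forall s, s \in `[0, T] -> m <= be s) ->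
  lip_family T (fun=> 1) (fun s _ => be s) ->
  lip_family T (fun=> 1) (fun s _ => c s) ->
  lip_family T (fun=> 1) (fun s _ => d s) ->
  lip_family T lorentz_weight (fun s x => lorentz (c s) (d s) (be s) x).
Proof.
move=> m0 mbe lbe lc ld; pose k s x := (be s ^+ 2 + x ^+ 2)^-1.
have lk : lip_family T lorentz_weight k by exact: lip_family_kernel m0 mbe lbe.
(* The identity (b^2 - x^2)/(b^2 + x^2) = 2 b^2/(b^2 + x^2) - 1 leaves the kernel as the only place
   where x occurs, so no unbounded factor x^2 has to be controlled. *)
pose f s x := 2 * (c s * be s + d s * (2 * (be s * be s) * k s x + - 1)) * k s
  x.
apply: (@lip_family_eq _ _ f) => [s x sT|].
  rewrite /f /lorentz /k; field.
  by rewrite gt_eqF// sqrD_gt0// (lt_le_trans m0)// mbe.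
apply: lip_family_weight => //; apply: lip_family_bounded;
  first exact: lip_family_cst.
apply: lip_familyD => //; first exact: lip_family_bounded.
apply: lip_family_bounded => //; apply: lip_familyD => //;
  last exact: lip_family_cst.
apply: lip_family_bounded; last exact: lip_family_weight1.
apply: lip_family_bounded; first exact: lip_family_cst.
exact: lip_family_bounded.
Qed.

End LipschitzFamilies.

(** * L^2 bounds by domination *)

Section SquareIntegrable.
Context {R : realType}.
Local Notation mu := (@lebesgue_measure R).
Implicit Types (f g : R -> R) (K : R).

Lemma integrable_sqr_weight f K : measurable_fun setT f ->
  (forall x, `|f x| <= K * lorentz_weight x) ->
  mu.-integrable setT (EFin \o fun x => f x ^+ 2).
Proof.
move=> mf fK.
have ig : mu.-integrable setT (EFin \o fun x : R => K ^+ 2 * lorentz_weight x).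
  exact: (integrableZl measurableT (K ^+ 2) integrable_oneDsqr_inv).
apply: (integrable_le _ ig) => [|x]; first exact: measurable_funX.
rewrite normrX (le_trans (lerXn2r 2 _ _ (fK x))) ?nnegrE//.
  exact: le_trans (fK x).
rewrite exprMn ler_wpM2l ?sqr_ge0// expr2 ler_piMr ?lorentz_weight_ge0//.
exact: lorentz_weight_le1.
Qed.

(** The weight is at most 1, so its square is below it, and its integral is pi. *)
Lemma Rintegral_sqr_weight_le f K : measurable_fun setT f ->
  (forall x, `|f x| <= K * lorentz_weight x) ->
  \int[mu]_x f x ^+ 2 <= K ^+ 2 * pi.
Proof.
move=> mf fK.
apply: (@le_trans _ _ (\int[mu]_x (K ^+ 2 * lorentz_weight x))).
  apply: le_Rintegral => //.
  - exact: integrable_sqr_weight fK.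
  - exact: (integrableZl measurableT (K ^+ 2) integrable_oneDsqr_inv).
  move=> x _; rewrite -real_normK ?num_real//.
  rewrite (le_trans (lerXn2r 2 _ _ (fK x))) ?nnegrE//.
    exact: le_trans (fK x).
  rewrite exprMn ler_wpM2l ?sqr_ge0// expr2 ler_piMr ?lorentz_weight_ge0//.
  exact: lorentz_weight_le1.
rewrite RintegralZl//; last exact: integrable_oneDsqr_inv.
by rewrite /Rintegral integral_oneDsqr_inv.
Qed.

Lemma Lnorm2_weight f K : measurable_fun setT f ->
  (forall x, `|f x| <= K * lorentz_weight x) ->
  Lnorm mu 2%:E (EFin \o f) = (Num.sqrt (\int[mu]_x f x ^+ 2))%:E.
Proof.
move=> mf fK; rewrite unlock /=.
rewrite (_ : (\int[mu]_x _)%E = (\int[mu]_x f x ^+ 2)%:E); last first.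
  rewrite fineK; last first.
    exact: (integrable_fin_num measurableT (integrable_sqr_weight mf fK)).
  apply: eq_integral => x _ /=; rewrite powR_mulrn// real_normK ?num_real//.
by rewrite poweR_EFin powR12_sqrt// Rintegral_ge0// => x _; exact: sqr_ge0.
Qed.

Lemma in_L2_weight f K : measurable_fun setT f ->
  (forall x, `|f x| <= K * lorentz_weight x) -> in_L2 f.
Proof.
move=> mf fK; apply/andP; split; rewrite inE//=.
by rewrite /finite_norm (Lnorm2_weight mf fK) ltry.
Qed.

Lemma L2_dist_weight f g K : measurable_fun setT f -> measurable_fun setT g ->
  (forall x, `|f x - g x| <= K * lorentz_weight x) ->
  L2_dist f g = (Num.sqrt (\int[mu]_x (f x - g x) ^+ 2))%:E.
Proof. by move=> mf mg fgK; apply: Lnorm2_weight fgK;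
  exact: measurable_funB. Qed.

Lemma L2_dist_weight_le f g K : measurable_fun setT f ->
  measurable_fun setT g ->
  (forall x, `|f x - g x| <= K * lorentz_weight x) ->
  (L2_dist f g <= (K * Num.sqrt pi)%:E)%E.
Proof.
move=> mf mg fgK; rewrite (L2_dist_weight mf mg fgK) lee_fin.
have K0 : 0 <= K.
  have := le_trans (normr_ge0 _) (fgK 0).
  by rewrite /lorentz_weight expr0n addr0 invr1 mulr1.
rewrite -[leRHS]ger0_norm ?mulr_ge0 ?sqrtr_ge0// -sqrtr_sqr ler_wsqrtr//.
rewrite exprMn sqr_sqrtr ?pi_ge0//; apply: Rintegral_sqr_weight_le => //.
exact: measurable_funB.
Qed.

End SquareIntegrable.

(** * Bochner integrals and the Duhamel formula *)

Section Bochner.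
Context {R : realType}.
Local Notation mu := (@lebesgue_measure R).
Implicit Types (t s K : R).

Lemma lip_within_continuous (D : set R) (f : R -> R) (L : R) : 0 <= L ->
  (forall s t, D s -> D t -> `|f s - f t| <= L * `|s - t|) ->
  {within D, continuous f}.
Proof.
move=> L0 fL; apply/subspace_continuousP => s Ds.
apply/cvgrPdist_le => e e0; near=> s'.
have Ds' : D s' by near: s'; exact: withinT.
have d : `|s - s'| <= e / (L + 1).
  near: s'; apply: cvg_within.
  have eL : 0 < e / (L + 1) by rewrite divr_gt0// ltr_wpDl.
  exact: (@cvgr_dist_le _ _ _ _ _ id s cvg_id _ eL).
rewrite (le_trans (fL _ _ Ds Ds'))// (le_trans (ler_wpM2l L0 d))//.
by rewrite mulrCA ler_piMr ?(ltW e0)// ler_pdivrMr ?ltr_wpDl// mul1r lerDl.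
Unshelve. all: by end_near. Qed.

Section RiemannSums.
Variables (t : R) (F : R -> R -> R).
Hypothesis t0 : 0 <= t.
Hypothesis mF : forall s, s \in `[0, t] -> measurable_fun setT (F s).
Hypothesis lF : lip_family t lorentz_weight F.

Let h n : R := t / n.+1%:R.

Let h_ge0 n : 0 <= h n. Proof. by rewrite divr_ge0. Qed.

Let node_in n (i : nat) : (i <= n.+1)%N -> i%:R * h n \in `[0, t].
Proof.
move=> ni; rewrite in_itv/= mulr_ge0//= /h mulrCA ler_piMr//.
by rewrite ler_pdivrMr// mul1r ler_nat.
Qed.

Let L2_F s : s \in `[0, t] -> in_L2 (F s).
Proof.
move=> st; have [K K0 FK] := lF; apply: (in_L2_weight (K := K) (mF st)) => x.
by have [] := FK s x st.
Qed.

(** Half-open cells partition the domain [0, t[ of the Bochner integral exactly. *)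
Let cell n (i : 'I_n.+1) : set R := `[i%:R * h n, i.+1%:R * h n[%classic.

Let cellP n (i : 'I_n.+1) : [/\ measurable (cell i), cell i `<=` `[0,
  t[%classic &
  (mu (cell i) < +oo)%E].
Proof.
split; first exact: measurable_itv.
- move=> s /=; rewrite !in_itv/= => /andP[is1 is2].
  have := node_in (ltnW (ltn_ord i)); have := @node_in n i.+1 (ltn_ord i).
  rewrite !in_itv/= => /andP[_ it] /andP[i0 _].
  by rewrite (le_trans i0 is1) (lt_le_trans is2 it).
- by rewrite /cell lebesgue_measure_itv/=; case: ifP => // _;
  rewrite -EFinB ltry.
Qed.

Let mu_cell n (i : 'I_n.+1) : fine (mu (cell i)) = h n.
Proof.
rewrite /cell lebesgue_measure_itv/= lte_fin -subr_gt0 -mulrBl -natrB//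
  subSnn mul1r.
(* The cell is empty only when t = 0, and then the step is 0 as well. *)
case: ifPn => [_|]; last by rewrite -leNgt => h0; apply/eqP;
  rewrite eq_le h_ge0 h0.
by rewrite -EFinB/= -mulrBl -natrB// subSnn mul1r.
Qed.

Definition riemann_simple n : L2_simple `[0, t[%classic :=
  @L2Simple R `[0, t[%classic n.+1 (@cell n) (fun i => F (i%:R * h n))
    (@cellP n) (fun i => L2_F (node_in (ltnW (ltn_ord i)))).

Let cell_of n s : s \in `[0, t[ -> exists2 i : 'I_n.+1, cell i s &
  forall j : 'I_n.+1, cell j s -> j = i.
Proof.
rewrite in_itv/= => /andP[s0 st].
have hp : 0 < h n by rewrite divr_gt0// (le_lt_trans s0).
have sh0 : 0 <= s / h n by rewrite divr_ge0.
have /andP[k1 k2] := truncn_itv sh0; set k := Num.trunc _ in k1 k2.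
have kn : (k < n.+1)%N.
  rewrite -(ltr_nat R) (le_lt_trans k1)// ltr_pdivrMr// /h mulrC divfK//
    pnatr_eq0.
exists (Ordinal kn).
  by rewrite /cell/= in_itv/= -ler_pdivlMr// k1/= -ltr_pdivrMr.
move=> j; rewrite /cell/= in_itv/= -ler_pdivlMr// -ltr_pdivrMr// => js.
by apply/val_inj => /=; rewrite -(truncn_def js).
Qed.

Let simple_funE n s (i : 'I_n.+1) : s \in `[0, t[ -> cell i s ->
  simple_fun (riemann_simple n) s = F (i%:R * h n).
Proof.
move=> st si; apply/funext => x; rewrite /simple_fun/= (bigD1 i)//=.
rewrite big1 => [|j ji]; first by rewrite addr0 indicE mem_set// mul1r.
rewrite indicE memNset ?mul0r// => sj; have [k _ Hk] := cell_of n st.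
by move/eqP: ji; apply; rewrite (Hk _ si) (Hk _ sj).
Qed.

Let cell_dist n s (i : 'I_n.+1) : cell i s -> `|s - i%:R * h n| <= h n.
Proof.
rewrite /cell/= in_itv/= => /andP[s1 s2]; rewrite ger0_norm ?subr_ge0//.
by rewrite lerBlDl ltW//; move: s2; rewrite -natr1 mulrDl mul1r.
Qed.

(** The squared distance [I] is Lipschitz in s, hence continuous, and the distance is its power
    1/2. *)
Let measurable_dist s0 : s0 \in `[0, t] ->
  measurable_fun `[0, t[%classic (fun s => L2_dist (F s) (F s0)).
Proof.
move=> s0t; have [K K0 FK] := lF.
have sub s : s \in `[0, t[ -> s \in `[0, t] by exact: subset_itv_co_cc.
pose I s := \int[mu]_x (F s x - F s0 x) ^+ 2.
have dK s x : s \in `[0, t] -> `|F s x - F s0 x| <= (K + K) * lorentz_weight x.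
  move=> st; have [Fs _] := FK s x st; have [Fs0 _] := FK s0 x s0t.
  by rewrite (le_trans (ler_normB _ _))// mulrDl lerD.
have E s : s \in `[0, t] -> L2_dist (F s) (F s0) = (I s `^ 2^-1)%:E.
  move=> st; rewrite powR12_sqrt; last by apply: Rintegral_ge0 => x _;
    exact: sqr_ge0.
  by apply: (L2_dist_weight (K := K + K)) (mF st) (mF s0t) _ => x; exact: dK.
have iI s : s \in `[0, t] -> mu.-integrable setT (EFin \o fun x =>
  (F s x - F s0 x) ^+ 2).
  move=> st; apply: (integrable_sqr_weight (K := K + K)) => [|x];
    last exact: dK.
  by apply: measurable_funB; exact: mF.
(* In p^2 - q^2 = (p - q)(p + q), K is the Lipschitz constant of p - q, each of p and q is at most K
   + K, and pi is the integral of the weight. *)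
pose L : R := K * (K + K + (K + K)) * pi.
have L0 : 0 <= L by rewrite !mulr_ge0 ?pi_ge0// !addr_ge0.
have IL s s' : s \in `[0, t] -> s' \in `[0, t] ->
  `|I s - I s'| <= L * `|s - s'|.
  move=> st s't; rewrite /I -RintegralB//; [|exact: iI..].
  have ig : mu.-integrable setT (EFin \o fun x : R =>
      K * `|s - s'| * (K + K + (K + K)) * lorentz_weight x).
    exact: (integrableZl measurableT (K * `|s - s'| * (K + K + (K + K)))
      integrable_oneDsqr_inv).
  have ii := integrableB measurableT (iI s st) (iI s' s't).
  apply: (le_trans (le_normr_Rintegral measurableT ii)).
  rewrite (_ : L * _ = \int[mu]_x (K * `|s - s'| * (K + K + (K + K)) *
    lorentz_weight x)); last first.
    rewrite RintegralZl//; last exact: integrable_oneDsqr_inv.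
    by rewrite /Rintegral integral_oneDsqr_inv /L /=; ring.
  apply: le_Rintegral => // [|x _]; first exact: integrable_norm.
  rewrite (_ : _ - _ = (F s x - F s' x) * ((F s x - F s0 x) + (F s' x - F s0
    x))); last by ring.
  rewrite normrM.
  have [_ /(_ s' s't) H] := FK s x st.
  have w0 := lorentz_weight_ge0 x; have w1 := lorentz_weight_le1 x.
  apply: (@le_trans _ _ (K * `|s - s'| * lorentz_weight x * (K + K + (K +
    K)))); last by rewrite mulrAC.
  rewrite ler_pM// (le_trans (ler_normD _ _))// lerD// (le_trans (dK _ _ _))//.
    by rewrite ler_piMr// addr_ge0.
  by rewrite ler_piMr// addr_ge0.
apply: (@eq_measurable_fun _ _ _ _ _ (EFin \o (fun s => I s `^ 2^-1))).
  by move=> s; rewrite inE/= => /sub st; rewrite E.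
apply/measurable_EFinP; apply: (measurableT_comp (measurable_powR _)) => //.
apply: subspace_continuous_measurable_fun => //.
by apply: (lip_within_continuous L0) => s s' /sub ? /sub ?; exact: IL.
Qed.

(** On each cell this is the distance to one fixed value of F, so it is a finite sum over the
    cells. *)
Lemma measurable_riemann_dist n : measurable_fun `[0, t[%classic
  (fun s => L2_dist (F s) (simple_fun (riemann_simple n) s)).
Proof.
apply: (@eq_measurable_fun _ _ _ _ _ (fun s =>
  (\sum_(i < n.+1) (\1_(cell i) s)%:E * L2_dist (F s) (F (i%:R * h n)))%E)).
  move=> s; rewrite inE/= => st; have [i si Hi] := cell_of n st.
  rewrite (simple_funE st si) (bigD1 i)//= indicE mem_set// mul1e.
  rewrite big1 ?adde0// => j ji; rewrite indicE memNset ?mul0e// => sj.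
  by move/eqP: ji; apply; exact: Hi.
apply: emeasurable_sum => i; apply: emeasurable_funM.
  by apply/measurable_EFinP; apply: measurable_indic; have [] := cellP i.
by apply: measurable_dist; apply: node_in; exact: ltnW (ltn_ord i).
Qed.

Lemma riemann_dist_cvg : (\int[mu]_(s in `[0%R, t[%classic)
  L2_dist (F s) (simple_fun (riemann_simple n) s))%E @[n --> \oo] --> 0%E.
Proof.
have [K K0 FK] := lF.
(* The error at each time is at most K h sqrt(pi), with h = t/(n + 1); integration over [0, t[ gives
   the second factor t. *)
pose C : R := K * Num.sqrt pi * t * t.
have ub n : (\int[mu]_(s in `[0%R, t[%classic)
    L2_dist (F s) (simple_fun (riemann_simple n) s) <= (C * n.+1%:R^-1)%:E)%E.
  apply: (@le_trans _ _ (\int[mu]_(s in `[0%R, t[%classic) (K * h n * Num.sqrt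
    pi)%:E)%E).
    apply: ge0_le_integral => //.
    - by move=> s _; exact: Lnorm_ge0.
    - exact: measurable_riemann_dist.
    - move=> s /= st; have [i si _] := cell_of n st;
      rewrite (simple_funE st si).
      have st' : s \in `[0, t] by exact: subset_itv_co_cc st.
      have it := node_in (ltnW (ltn_ord i)).
      apply: L2_dist_weight_le => [||x]; [exact: mF|exact: mF|].
      have [_ /(_ _ it) H] := FK s x st'.
      rewrite (le_trans H)// ler_wpM2r ?lorentz_weight_ge0// ler_wpM2l//.
      exact: cell_dist.
  rewrite integral_cst//= lebesgue_measure_itv/= lte_fin.
  case: ifPn => t1; last first.
    rewrite mule0 lee_fin /C mulr_ge0// !mulr_ge0// sqrtr_ge0//.
  by rewrite oppr0 adde0 -EFinM lee_fin /C /h le_eqVlt; apply/orP; left;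
    apply/eqP; field.
apply: (@squeeze_cvge _ _ _ _ (cst 0%E) _ (fun n => (C * n.+1%:R^-1)%:E)).
- apply: nearW => n; rewrite ub andbT; apply: integral_ge0 => s _;
  exact: Lnorm_ge0.
- exact: cvg_cst.
- apply: cvg_EFin; first exact: nearW.
  by rewrite -(mulr0 C); apply: cvgMr; exact: cvg_harmonic.
Qed.

Variable G : R -> R -> R.
Hypothesis dG : forall s x, s \in `[0, t] -> is_derive s 1 (G^~ x) (F s x).
Hypothesis mG : forall s, s \in `[0, t] -> measurable_fun setT (G s).

Lemma simple_integralE n x : simple_integral (riemann_simple n) x =
  \sum_(i < n.+1) h n * F (i%:R * h n) x.
Proof. by apply: eq_bigr => i _ /=; rewrite mu_cell. Qed.

(** For each x and each cell, the mean value theorem replaces the increment of G by h F(c, x) with c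
    in the cell, which differs from h F(node, x) by at most K h^2 times the weight. Summed over the
    n + 1 cells this is K t h times the weight, uniformly enough in x for an L^2 bound. *)
Lemma riemann_sum_cvg :
  L2_dist (fun x => G t x - G 0 x) (simple_integral (riemann_simple n)) @[n -->
    \oo] --> 0%E.
Proof.
have [K K0 FK] := lF.
have dist n x : `|G t x - G 0 x - simple_integral (riemann_simple n) x| <=
    K * t * h n * lorentz_weight x.
  have -> : G t x - G 0 x =
      \sum_(i < n.+1) (G (i.+1%:R * h n) x - G (i%:R * h n) x).
    rewrite -(big_mkord xpredT (fun i => G (i.+1%:R * h n) x - G (i%:R * h n)
      x)).
    rewrite (telescope_sumr (fun i => G (i%:R * h n) x))// mul0r.
    by rewrite /h mulrC divfK// pnatr_eq0.
  rewrite simple_integralE -sumrB (le_trans (ler_norm_sum _ _ _))//.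
  apply: (@le_trans _ _ (\sum_(i < n.+1) K * h n * h n * lorentz_weight x)).
    apply: ler_sum => i _; have it := node_in (ltnW (ltn_ord i)).
    have it1 := @node_in n i.+1 (ltn_ord i).
    have ii : i%:R * h n <= i.+1%:R * h n by rewrite ler_wpM2r// ler_nat.
    have sub c : c \in `[i%:R * h n, i.+1%:R * h n] -> c \in `[0, t].
      move: it it1; rewrite !in_itv/= => /andP[i0 _] /andP[_ i1] /andP[ic ci].
      by rewrite (le_trans i0 ic) (le_trans ci i1).
    have H1 c : c \in `]i%:R * h n, i.+1%:R * h n[ ->
      is_derive c 1 (G^~ x) (F c x).
      by move=> cI; apply/dG/sub/subset_itv_oo_cc.
    have H2 : {within `[i%:R * h n, i.+1%:R * h n], continuous (G^~ x)}.
      by apply: derivable_within_continuous => c /sub cT; have [] := dG x cT.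
    have [c cI ->] := MVT_segment ii H1 H2.
    have -> : i.+1%:R * h n - i%:R * h n = h n by rewrite -natr1; ring.
    rewrite mulrC -mulrBr normrM (ger0_norm (h_ge0 n)) mulrC.
    have [_ /(_ _ it) H] := FK c x (sub _ cI).
    have ch : `|c - i%:R * h n| <= h n.
      move: cI; rewrite in_itv/= => /andP[c1 c2]; rewrite ger0_norm ?subr_ge0//.
      by rewrite lerBlDl; move: c2; rewrite -natr1 mulrDl mul1r.
    rewrite [leRHS](_ : _ = K * h n * lorentz_weight x * h n); last by ring.
    rewrite ler_wpM2r// (le_trans H)// ler_wpM2r ?lorentz_weight_ge0//.
    by rewrite ler_wpM2l.
  rewrite sumr_const card_ord -mulr_natl le_eqVlt; apply/orP; left; apply/eqP.
  rewrite [LHS](_ : _ = K * (n.+1%:R * h n) * h n * lorentz_weight x);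
    last by ring.
  by rewrite (_ : n.+1%:R * h n = t)// mulrC divfK ?pnatr_eq0.
have ms n : measurable_fun setT (simple_integral (riemann_simple n)).
  rewrite (_ : simple_integral _ = fun x => \sum_(i < n.+1) h n * F (i%:R * h
    n) x); last first.
    by apply/funext => x; exact: simple_integralE.
  apply: measurable_sum => i; apply: measurable_funM => //; apply: mF.
  by apply: node_in; exact: ltnW (ltn_ord i).
pose C := K * t * t * Num.sqrt pi.
apply: (@squeeze_cvge _ _ _ _ (cst 0%E) _ (fun n => (C * n.+1%:R^-1)%:E)).
- apply: nearW => n; rewrite [X in X && _]Lnorm_ge0/=.
  rewrite (_ : C * _ = K * t * h n * Num.sqrt pi); last by rewrite /C /h; ring.
  apply: L2_dist_weight_le => //; apply: measurable_funB; apply: mG.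
    by rewrite in_itv/= t0 lexx.
  by rewrite in_itv/= t0 lexx.
- exact: cvg_cst.
- apply: cvg_EFin; first exact: nearW.
  by rewrite -(mulr0 C); apply: cvgMr; exact: cvg_harmonic.
Qed.

(** Fundamental theorem of calculus in L^2 from a derivative known pointwise in x: left-endpoint
    step functions approximate F, and their integrals approximate the increment of G. *)
Lemma is_bochner_integral : is_bochner `[0, t[%classic F (fun x =>
  G t x - G 0 x).
Proof.
split.
- by move=> s /= st; apply: L2_F; exact: subset_itv_co_cc st.
- have [K K0 FK] := lF.
  have z0 : 0 \in `[0, t] by rewrite in_itv/= lexx.
  have tt : t \in `[0, t] by rewrite in_itv/= t0 lexx.
  apply: (in_L2_weight (K := K * t)) => [|x].
    by apply: measurable_funB; exact: mG.
  have H1 c : c \in `]0, t[ -> is_derive c 1 (G^~ x) (F c x).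
    by move=> cI; apply/dG/subset_itv_oo_cc.
  have H2 : {within `[0, t], continuous (G^~ x)}.
    by apply: derivable_within_continuous => c cT; have [] := dG x cT.
  have [c cI ->] := MVT_segment t0 H1 H2.
  have [H _] := FK c x cI.
  by rewrite subr0 normrM (ger0_norm t0) mulrAC ler_wpM2r.
- exists riemann_simple; split.
  + exact: measurable_riemann_dist.
  + exact: riemann_dist_cvg.
  + exact: riemann_sum_cvg.
Qed.

End RiemannSums.
End Bochner.

(** * Lorentzian solutions of the integral equation *)

Section LorentzianSolution.
Context {R : realType}.
Local Notation mu := (@lebesgue_measure R).
Variables (eps T m A : R) (a b : R -> R).
Hypotheses (eps2 : eps * eps = 1) (T0 : 0 <= T) (m0 : 0 < m).
Hypothesis mb : forall s, s \in `[0, T] -> m <= b s.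
Hypothesis aA : forall s, s \in `[0, T] -> `|a s| <= A.
Hypothesis da : forall s, s \in `[0, T] -> is_derive s 1 a (eps * (a s ^+ 2 / b
  s)).
Hypothesis db : forall s, s \in `[0, T] -> is_derive s 1 b (1 - eps * a s).

Let b0 s : s \in `[0, T] -> 0 < b s.
Proof. by move=> sT; rewrite (lt_le_trans m0)// mb. Qed.

Let lip_a : lip_family T (fun=> 1) (fun s _ => a s).
Proof.
apply: (lip_family_derive (K := `|eps| * (A ^+ 2 * m^-1)) T0 da) => s sT.
rewrite normrM ler_wpM2l// normrM normrX normfV (gtr0_norm (b0 sT)).
rewrite ler_pM ?invr_ge0 ?exprn_ge0 ?(ltW (b0 sT))//.
  by rewrite lerXn2r ?nnegrE ?aA// (le_trans _ (aA sT)).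
by rewrite lef_pV2 ?posrE ?b0// mb.
Qed.

Let lip_b : lip_family T (fun=> 1) (fun s _ => b s).
Proof.
apply: (lip_family_derive (K := 1 + `|eps| * A) T0 db) => s sT.
by rewrite (le_trans (ler_normB _ _))// normr1 lerD2l normrM ler_wpM2l// aA.
Qed.

Let lip_restrict t f : t \in `[0, T] ->
  lip_family T (fun=> 1) f -> lip_family t (fun=> 1) f.
Proof.
rewrite in_itv/= => /andP[_ tT] [K K0 fK].
have sub s : s \in `[0, t] -> s \in `[0, T].
  by rewrite !in_itv/= => /andP[-> st]; exact: le_trans tT.
exists K => // s x /sub sT; have [f1 f2] := fK s x sT; split => // s' /sub;
  exact: f2.
Qed.

(** With G as below, eps G(t) = u(t) and eps G(0) = S(t) u(0), while the derivative of G is S(t - s)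
    u^2(s). The integral equation is thus the integrated form of this derivative, multiplied by
    eps. *)
Lemma is_solution_lorentz :
  is_solution eps T (lorentz (a 0) 0 (b 0)) (fun s => lorentz (a s) 0 (b s)).
Proof.
have lu : lip_family T lorentz_weight (fun s => lorentz (a s) 0 (b s)).
  exact: (lip_family_lorentz m0 mb lip_b lip_a (lip_family_cst T 0)).
have mu_ s : s \in `[0, T] -> measurable_fun setT (lorentz (a s) 0 (b s)).
  by move=> sT; apply: continuous_measurable_fun; apply: continuous_lorentz;
    exact: b0.
split.
- split=> [s sT|s sT].
    have [K _ uK] := lu; apply: (in_L2_weight (K := K)) => [|x];
      first exact: mu_.
    by have [] := uK s x sT.
  have [K K0 uK] := lu.
  apply: (@squeeze_cvge _ _ _ _ (cst 0%E) _ (fun s' =>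
    (K * `|s' - s| * Num.sqrt pi)%:E)).
  + near=> s'; have s'T : s' \in `[0, T] by near: s'; exact: withinT.
    rewrite [X in X && _]Lnorm_ge0/=; apply: L2_dist_weight_le => [||x];
      [exact: mu_..|].
    by have [_ ] := uK s' x s'T; exact.
  + exact: cvg_cst.
  + apply: cvg_EFin; first exact: nearW.
    rewrite -(mul0r (Num.sqrt pi)); apply: cvgMl; rewrite -(mulr0 K);
      apply: cvgMr.
    rewrite -(normr0 R); apply: cvg_norm; rewrite -(subrr s).
    by apply: cvgB; [apply: cvg_within_filter; exact: cvg_id|exact: cvg_cst].
- exact: ae_eq_refl.
- move=> t tT; have := tT; rewrite in_itv/= => /andP[t0 tT'].
  have sub s : s \in `[0, t] -> s \in `[0, T].
    by rewrite !in_itv/= => /andP[-> st]; exact: le_trans tT'.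
  (* S(t - s) applied to a Lorentzian of width b s has width be s, and G is
     eps times S(t - s) (u s). *)
  pose be s := b s + (t - s).
  have mbe s : s \in `[0, t] -> m <= be s.
    move=> st; rewrite (le_trans (mb (sub s st)))// lerDl subr_ge0.
    by move: st; rewrite in_itv/= => /andP[].
  have be0 s : s \in `[0, t] -> 0 < be s by move=> st;
    rewrite (lt_le_trans m0)// mbe.
  pose F s := lorentz (a s ^+ 2 / b s) (a s ^+ 2) (be s).
  pose G s := lorentz (eps * a s) 0 (be s).
  have mF s : s \in `[0, t] -> measurable_fun setT (F s).
    move=> st; apply: continuous_measurable_fun; apply: continuous_lorentz;
      exact: be0.
  have mG s : s \in `[0, t] -> measurable_fun setT (G s).
    move=> st; apply: continuous_measurable_fun; apply: continuous_lorentz;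
      exact: be0.
  have lF : lip_family t lorentz_weight F.
    have la2 : lip_family t (fun=> 1) (fun s _ => a s ^+ 2).
      apply: (@lip_family_eq _ _ _ (fun s _ => a s * a s)) => [s x _|].
        by rewrite expr2.
      by apply: lip_family_bounded; exact: lip_restrict.
    apply: (lip_family_lorentz m0 mbe) => //.
      apply: lip_familyD => //; first exact: lip_restrict.
      have H1 (s : R) : s \in `[0, t] -> is_derive s 1 (fun s => t - s) (-1).
        by move=> _; derive_tac; rewrite add0r.
      have H2 (s : R) : s \in `[0, t] -> `|-1 : R| <= 1 by rewrite normrN
        normr1.
      exact: (lip_family_derive (df := fun=> -1) t0 H1 H2).
    apply: lip_family_bounded => //; apply: lip_restrict => //.
    exact: lip_family_inv m0 mb lip_b.
  have dG s x : s \in `[0, t] -> is_derive s 1 (G^~ x) (F s x).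
    move=> st; have sT := sub s st; have := da sT; have := db sT => d1 d2.
    have bs0 := b0 sT; have bes0 := be0 s st.
    have Ds := sqrD_gt0 x bes0; rewrite /be in Ds.
    rewrite (_ : G^~ x = fun s => 2 * (eps * a s * (b s + (t - s)) /
        ((b s + (t - s)) ^+ 2 + x ^+ 2))); last first.
      by apply/funext => s'; rewrite /G /lorentz /be !mul0r addr0.
    derive_tac; first by rewrite gt_eqF.
    (* The width satisfies be' = b' - 1 = -eps a, so a' and be' each contribute one factor eps
       besides the one in G; they yield the a^2/b and a^2 terms of F respectively. *)
    transitivity (eps * eps * F s x); last by rewrite eps2 mul1r.
    rewrite /F /lorentz /be /=; move: Ds bs0.
    move: (a s) (b s) (b s + (t - s)) => A' B' be' Ds bs0; field.
    by rewrite (gt_eqF bs0) (gt_eqF Ds).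
  exists (lorentz (a 0) 0 (b 0 + t)), F, (fun x => G t x - G 0 x); split.
  + by apply: is_frac_heat_lorentz => //; apply: b0; rewrite in_itv/= lexx.
  + move=> s st; have st' : s \in `[0, t] by exact: subset_itv_co_cc st.
    rewrite (_ : (fun x => _) = lorentz (a s ^+ 2 / b s) (a s ^+ 2) (b s));
      last first.
      by apply/funext => x; rewrite lorentz_sqr// b0// sub.
    apply: is_frac_heat_lorentz; first by rewrite b0// sub.
    by move: st'; rewrite in_itv/= subr_ge0 => /andP[].
  + exact: (is_bochner_integral t0 mF lF dG mG).
  + rewrite (_ : lorentz (a t) 0 (b t) = fun x =>
    lorentz (a 0) 0 (b 0 + t) x + eps * (G t x - G 0 x)).
      exact: ae_eq_refl.
    apply/funext => x; rewrite mulrBr.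
    have E s : eps * G s x = lorentz (a s) 0 (be s) x.
      transitivity (eps * eps * lorentz (a s) 0 (be s) x);
        last by rewrite eps2 mul1r.
      by rewrite /G /lorentz; ring.
    by rewrite !E /be subr0 subrr addr0 addrC subrK.
Unshelve. all: by end_near. Qed.

End LorentzianSolution.

(** * Norm inflation *)

Section Profile.
Context {R : realType}.
Implicit Types (C s t : R).

Definition profile s : R := (1 + s) * expR (- s).

Lemma is_derive_profile s : is_derive s 1 profile (- (s * expR (- s))).
Proof. by rewrite /profile; derive_tac; ring. Qed.

Lemma profile_lt s s' : 0 <= s -> s < s' -> profile s' < profile s.
Proof.
move=> s0 ss'.
have H1 x : x \in `]s, s'[ -> is_derive x 1 profile (- (x * expR (- x))).
  by move=> _; exact: is_derive_profile.
have H2 : {within `[s, s'], continuous profile}.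
  by apply: derivable_within_continuous => x _; have [] := is_derive_profile x.
have [c cI e] := MVT ss' H1 H2.
rewrite -subr_lt0 e mulNr oppr_lt0 mulr_gt0 ?subr_gt0// mulr_gt0 ?expR_gt0//.
by move: cI; rewrite in_itv/= => /andP[sc _]; exact: le_lt_trans sc.
Qed.

Lemma profile_le s s' : 0 <= s -> s <= s' -> profile s' <= profile s.
Proof.
move=> s0; rewrite le_eqVlt => /predU1P[->//|ss'].
exact/ltW/profile_lt.
Qed.

Lemma profile_inj s s' : 0 <= s -> 0 <= s' -> profile s = profile s' -> s = s'.
Proof.
move=> s0 s'0 e; have [ss'|ss'|//] := ltgtP s s'.
  by have := profile_lt s0 ss'; rewrite e ltxx.
by have := profile_lt s'0 ss'; rewrite e ltxx.
Qed.

Lemma profile_le1 s : 0 <= s -> profile s <= 1.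
Proof.
move=> s0; rewrite /profile expRN ler_pdivrMr ?expR_gt0// mul1r.
exact: expR_ge1Dx.
Qed.

Lemma profile_ge0 s : 0 <= s -> 0 <= profile s.
Proof. by move=> s0; rewrite mulr_ge0 ?expR_ge0// addr_ge0. Qed.

(** [sig] inverts [tau], where tau s is the time at which the inverse amplitude has decreased from
    s0 to s. *)
Lemma profile_inverse C s0 s1 : 0 < C -> 0 < s1 -> s1 < s0 ->
  let T := C * (profile s1 - profile s0) in
  exists sig : R -> R, [/\ sig 0 = s0, sig T = s1 &
    forall t, t \in `[0, T] -> (s1 <= sig t <= s0) /\
      is_derive t 1 sig (- (C * (sig t * expR (- sig t)))^-1)].
Proof.
move=> C0 s10 s1s0 T; pose tau s := C * (profile s - profile s0).
have tauK s s' : 0 <= s -> 0 <= s' -> tau s = tau s' -> s = s'.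
  move=> ss ss' /(mulfI (lt0r_neq0 C0))/addIr; exact: profile_inj.
(* Inverting on all positive s, and not on [s1, s0] alone, makes [sig] a left inverse around the
   endpoints too, so its derivatives at 0 and T are two-sided. *)
pose sig t := xget s0 [set s | 0 < s /\ tau s = t].
have sigK s : 0 < s -> sig (tau s) = s.
  move=> sp; rewrite /sig; case: xgetP => [y _ [y0 e]|/(_ s)]; last by case.
  by apply: tauK => //; exact: ltW.
have s00 : 0 < s0 by exact: lt_trans s1s0.
have dtau s : is_derive s 1 tau (- (C * (s * expR (- s)))).
  have := is_derive_profile s => dp; rewrite /tau; derive_tac; ring.
have onto t : t \in `[0, T] -> exists2 s, s1 <= s <= s0 & tau s = t.
  rewrite in_itv/= => /andP[t0 tT].
  have cT : {within `[s1, s0], continuous tau}.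
    by apply: derivable_within_continuous => x _; have [] := dtau x.
  have [|s] := @IVT R tau s1 s0 t (ltW s1s0) cT.
    rewrite ge_min le_max; apply/andP; split; apply/orP; last by left.
    by right; rewrite /tau subrr mulr0.
  by rewrite in_itv/= => sI e; exists s.
exists sig; split.
- by rewrite -[X in sig X](_ : tau s0 = 0) ?sigK// /tau subrr mulr0.
- by rewrite -[X in sig X](_ : tau s1 = T) ?sigK.
- move=> t /onto [s /andP[s1s ss0] <-].
  have sp : 0 < s by exact: lt_le_trans s1s.
  rewrite sigK// s1s ss0; split => //; rewrite -invrN.
  apply: is_derive_inverse.
  + near=> x; apply: sigK; near: x; exact: lt_nbhsr.
  + by near=> x; exact: is_derive_continuous (dtau x).
  + by rewrite oppr_eq0 gt_eqF// !mulr_gt0// expR_gt0.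
Unshelve. all: by end_near. Qed.

End Profile.

Section Inflation.
Context {R : realType}.
Local Notation mu := (@lebesgue_measure R).

(** [C] is chosen so that going from s0 to s1 takes exactly the time T. With a = eps/s one has eps a
    = 1/s for either sign, so the width and s evolve in the same way for both equations. *)
Lemma inflating_solution (eps T s0 s1 : R) : eps * eps = 1 -> 0 < T ->
  0 < s1 -> s1 < s0 -> let C := T / (profile s1 - profile s0) in
  exists u : R -> R -> R,
    [/\ is_solution eps T (u 0) u,
        u 0 = lorentz (eps / s0) 0 (C * (s0 * expR (- s0))) &
        u T = lorentz (eps / s1) 0 (C * (s1 * expR (- s1)))].
Proof.
move=> eps2 T0 s10 s1s0 C.
have s00 : 0 < s0 by exact: lt_trans s1s0.
have D0 : 0 < profile s1 - profile s0 by rewrite subr_gt0 profile_lt// ltW.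
have C0 : 0 < C by rewrite divr_gt0.
have [sig []] := profile_inverse C0 s10 s1s0.
rewrite divfK ?gt_eqF// => sig0 sigT dsig.
have sI t : t \in `[0, T] -> s1 <= sig t <= s0 by move=> /dsig[].
have sp t : t \in `[0, T] -> 0 < sig t.
  by move=> /sI/andP[st _]; exact: lt_le_trans st.
have dsg t : t \in `[0, T] -> is_derive t 1 sig (- (C * (sig t * expR (- sig
  t)))^-1).
  by move=> /dsig[].
pose a t := eps / sig t; pose b t := C * (sig t * expR (- sig t)).
have bp t : t \in `[0, T] -> 0 < b t.
  by move=> /sp st; exact: mulr_gt0 C0 (mulr_gt0 st (expR_gt0 _)).
have da t : t \in `[0, T] -> is_derive t 1 a (eps * (a t ^+ 2 / b t)).
  move=> tT; have := dsg t tT => d; have st := sp t tT; have bt := bp t tT.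
  have -> : a t ^+ 2 = (sig t)^-1 ^+ 2 by rewrite exprMn (expr2 eps) eps2 mul1r.
  rewrite /a /b; derive_tac; first by rewrite gt_eqF.
  field.
  by rewrite !gt_eqF ?expR_gt0.
have db t : t \in `[0, T] -> is_derive t 1 b (1 - eps * a t).
  move=> tT; have := dsg t tT => d; have st := sp t tT.
  have -> : eps * a t = (sig t)^-1 by rewrite /a mulrA eps2 mul1r.
  rewrite /b; derive_tac; field.
  by rewrite !gt_eqF ?expR_gt0.
exists (fun t => lorentz (a t) 0 (b t)); split.
(* The width is bounded below factor by factor, by s >= s1 and e^{-s} >= e^{-s0}, as s e^{-s} is not
   monotone across s = 1. *)
- apply: (@is_solution_lorentz R eps T (C * (s1 * expR (- s0))) s1^-1 a b) =>
  //.
  + exact: ltW.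
  + exact: mulr_gt0 C0 (mulr_gt0 s10 (expR_gt0 _)).
  + move=> t tT; have /andP[t1 t2] := sI t tT; rewrite /b ler_pM2l//.
    by rewrite ler_pM ?expR_ge0 ?(ltW s10)// ler_expR lerN2.
  + move=> t tT; have /andP[t1 t2] := sI t tT; have st := sp t tT.
    rewrite /a normrM normfV (gtr0_norm st) (_ : `|eps| = 1) ?mul1r ?lef_pV2//.
    by apply/eqP; rewrite -(eqrXn2 (n := 2))// -normrX expr2 eps2 normr1 expr1n.
- by rewrite /a /b sig0.
- by rewrite /a /b sigT.
Qed.

End Inflation.

Theorem theorem3 (R : realType) (eps : R) (heps : eps = 1 \/ eps = -1) :
  exists (T : nat -> R) (phi : nat -> R -> R) (u : nat -> R -> R -> R),
    [/\ forall N, 0 < T N, decreasing_seq T & T N @[N --> \oo] --> 0] /\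
    [/\ forall N, in_L2 (phi N) & forall N, is_solution eps (T N) (phi N) (u
      N)] /\
    exists a b : nat -> R,
      [/\ forall N, is_sobolev_norm (- 2^-1) (phi N) (a N),
          forall N, is_sobolev_norm (- 2^-1) (u N (T N)) (b N),
          a N @[N --> \oo] --> 0 &
          b N @[N --> \oo] --> +oo].
Proof.
have eps2 : eps * eps = 1 by case: heps => ->; rewrite ?mulrNN mulr1.
have eps1 : `|eps| = 1 by case: heps => ->; rewrite ?normrN normr1.
pose T N : R := N.+1%:R^-1; pose s0 N : R := N.+2%:R; pose s1 N : R :=
  N.+1%:R^-1.
have T0 N : 0 < T N by rewrite invr_gt0.
have s10 N : 0 < s1 N by rewrite invr_gt0.
have s11 N : s1 N <= 1 by rewrite invf_le1// ler1n.
have s02 N : 2 <= s0 N by rewrite ler_nat.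
have s00 N : 0 < s0 N by rewrite ltr0n.
have s1s0 N : s1 N < s0 N by rewrite (le_lt_trans (s11 N))// ltr1n.
pose C N := T N / (profile (s1 N) - profile (s0 N)).
have [u uP] := choice (fun N => inflating_solution eps2 (T0 N) (s10 N) (s1s0
  N)).
(* As s1 <= 1 and s0 >= 2, the drop of the profile lies between [c] and 1, whence T <= C <= 1/c
   uniformly in N. *)
pose c : R := profile 1 - profile 2.
have c0 : 0 < c by rewrite subr_gt0 profile_lt// ltr1n.
have D0 N : 0 < profile (s1 N) - profile (s0 N) by rewrite subr_gt0
  profile_lt// ltW.
have Dc N : c <= profile (s1 N) - profile (s0 N).
  by rewrite lerB// profile_le// ltW.
have D1 N : profile (s1 N) - profile (s0 N) <= 1.
  by rewrite lerBlDr (le_trans (profile_le1 (ltW (s10 N))))//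
    lerDl profile_ge0// ltW.
have C0 N : 0 < C N by rewrite divr_gt0.
have CT N : T N <= C N by rewrite ler_pdivlMr// ler_piMr// ltW.
have Cc N : C N <= c^-1.
  (* T N and s1 N are the same number. *)
  rewrite ler_pdivrMr// (le_trans (s11 N : T N <= 1))// -(mulVf (lt0r_neq0 c0)).
  by rewrite ler_wpM2l// invr_ge0 ltW.
pose b0 N := C N * (s0 N * expR (- s0 N)); pose b1 N :=
  C N * (s1 N * expR (- s1 N)).
have b00 N : 0 < b0 N by exact: mulr_gt0 (C0 N) (mulr_gt0 (s00 N) (expR_gt0 _)).
have b10 N : 0 < b1 N by exact: mulr_gt0 (C0 N) (mulr_gt0 (s10 N) (expR_gt0 _)).
have u0 N : u N 0 = lorentz (eps / s0 N) 0 (b0 N) by have [] := uP N.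
have uT N : u N (T N) = lorentz (eps / s1 N) 0 (b1 N) by have [] := uP N.
have nV (s : R) : 0 < s -> `|eps / s| = s^-1.
  by move=> sp; rewrite normrM eps1 mul1r gtr0_norm// invr_gt0.
have cT : T N @[N --> \oo] --> 0 by exact: cvg_harmonic.
exists T, (fun N => u N 0), u; split; [|split].
- split=> // n m; rewrite /T lef_pV2 ?posrE// ler_nat ltnS//.
- split=> N; last by have [] := uP N.
  rewrite u0; have [K uK] := lorentz_dominated (eps / s0 N) 0 (b00 N).
  apply: in_L2_weight uK; apply: continuous_measurable_fun.
  exact: continuous_lorentz.
exists (fun N => 2 * pi * `|eps / s0 N| * Num.sqrt (\int[lebesgue_measure]_y
  sobolev_density (b0 N) y)).
exists (fun N => 2 * pi * `|eps / s1 N| * Num.sqrt (\int[lebesgue_measure]_y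
  sobolev_density (b1 N) y)).
have pi2 : 0 <= 2 * pi :> R by rewrite mulr_ge0// pi_ge0.
split.
- by move=> N; rewrite u0; exact: is_sobolev_norm_lorentz.
- by move=> N; rewrite uT; exact: is_sobolev_norm_lorentz.
(* C s0 >= T s0 >= 1 gives b0 >= e^{-s0}, so this e is below 2 b0, and -ln e = 2 s0. *)
- pose e N := expR (- (2 * s0 N)).
  have eh N : e N <= 2^-1.
    rewrite /e expRN lef_pV2 ?posrE ?expR_gt0// (le_trans _ (expR_ge1Dx _))//.
    by have := s02 N; lra.
  have e1 N : e N < 1 by rewrite (le_lt_trans (eh N))// invf_lt1// ltr1n.
  have eb N : e N <= 2 * b0 N.
    have Cs : 1 <= C N * s0 N.
      rewrite (le_trans _ (ler_wpM2r (ltW (s00 N)) (CT N)))//.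
      by rewrite /T /s0 mulrC ler_pdivlMr// mul1r ler_nat.
    rewrite /b0 mulrA (@le_trans _ _ (expR (- s0 N)))//.
      by rewrite ler_expR lerN2; have := s00 N; lra.
    rewrite mulrA ler_peMl ?expR_ge0//; lra.
  (* As e <= 1/2, the integral is at most 8 s0/(1 - e) <= 16 s0. With the amplitude 1/s0, the norm
     is at most 8 pi / sqrt(s0). *)
  have I N : Num.sqrt (\int[lebesgue_measure]_y sobolev_density (b0 N) y) <= 4
    * Num.sqrt (s0 N).
    rewrite -[4]ger0_norm// -sqrtr_sqr -sqrtrM ?sqr_ge0// ler_wsqrtr//.
    apply: (le_trans (Rintegral_sobolev_density_le (expR_gt0 _) (e1 N) (eb N))).
    rewrite expRK opprK -/(e N) ler_pdivrMr ?subr_gt0//.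
    rewrite (_ : 4 * (2 * s0 N) = 4 ^+ 2 * s0 N * 2^-1); last by field.
    rewrite ler_wpM2l//; first by rewrite mulr_ge0 ?sqr_ge0 ?(ltW (s00 N)).
    by have := eh N; lra.
  apply: (@squeeze_cvgr _ _ _ _ (cst 0) (fun N => 8 * pi * Num.sqrt (s0 N)^-1)).
  + apply: nearW => N; rewrite !mulr_ge0 ?pi_ge0 ?sqrtr_ge0//=.
    rewrite nV//; have H := I N.
    have ss : (s0 N)^-1 * Num.sqrt (s0 N) = Num.sqrt (s0 N)^-1.
      rewrite sqrtrV ?(ltW (s00 N))// -{1}[s0 N]sqr_sqrtr ?(ltW (s00 N))//.
      by rewrite expr2 invfM -mulrA mulVf ?mulr1// gt_eqF// sqrtr_gt0.
    rewrite -ss [leRHS](_ : _ = 2 * pi * (s0 N)^-1 * (4 * Num.sqrt (s0 N)));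
      last by ring.
    by rewrite ler_wpM2l// mulr_ge0// invr_ge0 ltW.
  + exact: cvg_cst.
  + rewrite -(mulr0 (8 * pi)); apply: cvgMr; rewrite -(sqrtr0 R).
    apply: (@continuous_cvg _ _ _ _ _ _ (@Num.sqrt R));
      first exact: sqrt_continuous.
    rewrite /s0; apply: (@squeeze_cvgr _ _ _ _ (cst 0) T) => //;
      last exact: cvg_cst.
    by apply: nearW => N; rewrite invr_ge0 ler0n/= lef_pV2 ?posrE// ler_nat.
(* The final width is at most C <= 1/c because s1 <= 1, so the integral is bounded below
   independently of N, while the amplitude is N + 1. *)
- pose k := 2 * pi * Num.sqrt (2^-1 * expR (- (2 * c^-1))).
  have k0 : 0 < k.
    by rewrite !mulr_gt0 ?pi_gt0// sqrtr_gt0 mulr_gt0 ?expR_gt0.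
  apply: (@ger_cvgy _ _ _ _ (fun N => k * N.+1%:R)).
    apply: nearW => N; rewrite nV// /s1 invrK /k mulrAC ler_wpM2l ?mulr_ge0
      ?pi_ge0//.
    rewrite ler_wsqrtr//; apply: Rintegral_sobolev_density_ge => //.
    rewrite (le_trans _ (Cc N))// ler_piMr ?(ltW (C0 N))//
      mulr_ile1 ?expR_ge0 ?(ltW (s10 N))//.
    by rewrite -expR0 ler_expR oppr_le0 ltW.
  have cN : (n.+1%:R : R) @[n --> \oo] --> +oo.
    apply: (@ger_cvgy _ _ _ _ (fun n : nat => n%:R)); last exact: cvgr_idn.
    by apply: nearW => n; rewrite ler_nat.
  exact: (cvg_comp (fun n => n.+1%:R) (fun y : R => k * y) cN
    (gt0_cvgMry k0 cvg_id)).
Qed.
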